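(* Let $n\ge1$ be an integer and $s\in(0,1)$. The constant $\kappa(n,s)$ in the explicit formula for the Green function of the ball has the value $$\kappa(n,s)=\frac{\Gamma(\frac n2)}{2^{2s}\pi^{\frac n2}\Gamma^2(s)}\quad\text{for }n\ne2s,\qquad\qquad \kappa\Big(1,\frac12\Big)=\frac1\pi\quad\text{for }n=2s.$$
   Context: $B_r=\{x\in\mathbb{R}^n:|x|<r\}$. For $x\in\mathbb{R}^n\setminus\{0\}$, $$\Phi(x):=\begin{cases}a(n,s)\,|x|^{-n+2s}& \text{if } n\ne2s,\\ a(1,\frac12)\log|x| & \text{if } n=2s,\end{cases}\qquad a(n,s):=\frac{\Gamma(\frac n2-s)}{2^{2s}\pi^{\frac n2}\Gamma(s)}\ (n\neq2s),\qquad a\Big(1,\frac12\Big):=-\frac1\pi,$$ where $\Gamma$ is the Gamma function, extended to negative non-integer arguments. For $x\in B_r$ and $y\in\mathbb{R}^n\setminus\overline B_r$, $$P_r(y,x):=c(n,s)\Big(\frac{r^2-|x|^2}{|y|^2-r^2}\Big)^s\frac1{|x-y|^n},\qquad c(n,s):=\frac{\Gamma(\frac n2)\sin(\pi s)}{\pi^{\frac n2+1}}.$$ For $x,z\in B_r$, $x\ne z$, the Green function is $$G(x,z):=\Phi(x-z)-\int_{\mathbb{R}^n\setminus B_r}\Phi(z-y)\,P_r(y,x)\,dy.$$ The constant $\kappa(n,s)$, depending only on $n$ and $s$, is the one for which the following identities hold for all $r>0$ and all $x,z\in B_r$ with $x\neq z$. If $n\ne2s$, $$G(x,z)=\kappa(n,s)\,|z-x|^{2s-n}\int_0^{r_0(x,z)}\frac{t^{s-1}}{(t+1)^{\frac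 n2}}\,dt,\qquad r_0(x,z)=\frac{(r^2-|x|^2)(r^2-|z|^2)}{r^2|x-z|^2}.$$ If $n=2s$ (that is, $n=1$, $s=\frac12$), $$G(x,z)=\kappa\Big(1,\frac12\Big)\log\bigg(\frac{r^2-xz+\sqrt{(r^2-x^2)(r^2-z^2)}}{r|z-x|}\bigg).$$ *)

(* Defs.v *)
From HB Require Import structures.
From mathcomp Require Import all_boot all_order all_algebra.
From mathcomp Require Import all_classical all_reals all_analysis.
Set Implicit Arguments.
Unset Strict Implicit.
Unset Printing Implicit Defensive.
Import Order.TTheory GRing.Theory Num.Theory.
Import numFieldNormedType.Exports.
Local Open Scope classical_set_scope.
Local Open Scope ring_scope.

Section cons_measure.
Context {R : realType} (n : nat).
Implicit Type m : {sigma_finite_measure set (n.-tuple R) -> \bar R}.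

Definition cons_pair (p : R * n.-tuple R) : n.+1.-tuple R :=
  [the n.+1.-tuple R of p.1 :: p.2].

Lemma measurable_cons_pair : measurable_fun [set: R * n.-tuple R] cons_pair.
Proof.
exact: (@measurable_cons _ _ (R * n.-tuple R)%type R fst n snd
  measurable_fst measurable_snd).
Qed.

Definition cons_measure m : set (n.+1.-tuple R) -> \bar R :=
  pushforward (@lebesgue_measure R \x m)%E cons_pair.

Variable m : {sigma_finite_measure set (n.-tuple R) -> \bar R}.

Let cons_measure0 : cons_measure m set0 = 0%E.
Proof. by rewrite /cons_measure /pushforward preimage_set0 measure0. Qed.

Let cons_measure_ge0 A : (0 <= cons_measure m A)%E.
Proof. by rewrite /cons_measure /pushforward measure_ge0. Qed.

Let cons_measure_sigma_additive : semi_sigma_additive (cons_measure m).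
Proof.
move=> F mF tF mUF; rewrite /cons_measure /pushforward preimage_bigcup.
have mp A : measurable A -> measurable (cons_pair @^-1` A).
  by move=> mA; rewrite -[X in measurable X]setTI; exact: measurable_cons_pair.
apply: measure_semi_sigma_additive.
- by move=> k; exact: mp.
- apply/trivIsetP => /= i j _ _ ij; rewrite -preimage_setI.
  by move/trivIsetP : tF => /(_ _ _ _ _ ij) ->//; rewrite preimage_set0.
- by rewrite -preimage_bigcup; exact: mp.
Qed.

HB.instance Definition _ := isMeasure.Build _ _ _ (cons_measure m)
  cons_measure0 cons_measure_ge0 cons_measure_sigma_additive.

Lemma cons_measureX (A : set R) (B : set (n.-tuple R)) :
  measurable A -> measurable B ->
  cons_measure m [set t | A (thead t) /\ B [tuple of behead t]] =
  (lebesgue_measure A * m B)%E.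
Proof.
move=> mA mB; rewrite /cons_measure /pushforward.
rewrite -(product_measure1E (@lebesgue_measure R) m mA mB).
congr ((_ \x _)%E _); apply/seteqP.
by split=> -[a t] /=; rewrite (_ : [tuple of _] = t)//; exact/val_inj.
Qed.

Let cons_measure_sigma_finite : sigma_finite setT (cons_measure m).
Proof.
have /sigma_finiteP[F [TF ndF Foo]] := sigma_finiteT (@lebesgue_measure R).
have /sigma_finiteP[G [TG ndG Goo]] := sigma_finiteT m.
exists (fun k => [set t | F k (thead t) /\ G k [tuple of behead t]]).
  apply/esym; rewrite -subTset => t _.
  have [k _ Fk] : (\bigcup_k F k) (thead t) by rewrite -TF.
  have [l _ Gl] : (\bigcup_k G k) [tuple of behead t] by rewrite -TG.
  exists (maxn k l) => //; split.
    by move: Fk; exact/subsetPset/ndF/leq_maxl.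
  by move: Gl; exact/subsetPset/ndG/leq_maxr.
move=> k; have [mF Fk] := Foo k; have [mG Gk] := Goo k; split.
  apply: measurableI; rewrite -[X in measurable X]setTI.
    exact: (measurable_tnth ord0).
  exact: measurable_behead.
by rewrite cons_measureX// lte_mul_pinfty// ge0_fin_numE.
Qed.

HB.instance Definition _ := Measure_isSigmaFinite.Build _ _ _ (cons_measure m)
  cons_measure_sigma_finite.

End cons_measure.

Section dirac_nil.
Context {R : realType}.

Definition nil_measure : set (0.-tuple R) -> \bar R := @dirac _ _ [tuple] R.
HB.instance Definition _ := Measure.on nil_measure.

Let nil_measure_sigma_finite : sigma_finite setT nil_measure.
Proof.
apply: fin_num_fun_sigma_finite; first by rewrite measure0.
exact: fin_num_measure.
Qed.

HB.instance Definition _ := Measure_isSigmaFinite.Build _ _ _ nil_measure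
  nil_measure_sigma_finite.
End dirac_nil.

(* Lebesgue measure on R^n, as the n-fold product of [lebesgue_measure] *)
Fixpoint lebesgue_tuple (R : realType) (n : nat) :
    {sigma_finite_measure set (n.-tuple R) -> \bar R} :=
  match n with
  | 0 => @nil_measure R
  | k.+1 => cons_measure (lebesgue_tuple R k)
  end.

Lemma lebesgue_tuple_box (R : realType) (n : nat) (A : 'I_n -> set R) :
  (forall i, measurable (A i)) ->
  lebesgue_tuple R n [set t | forall i, A i (tnth t i)] =
  (\prod_(i < n) lebesgue_measure (A i))%E.
Proof.
elim: n A => [|n IH] A mA.
  rewrite big_ord0 /= /nil_measure diracE mem_set//=.
  by case.
rewrite big_ord_recl -IH; last by move=> i; exact: mA.
have mB : measurable [set t : n.-tuple R | forall i, A (lift ord0 i) (tnth t i)].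
  rewrite (_ : [set t | _] =
      \bigcap_(i in [set: 'I_n]) ((@tnth n R)^~ i @^-1` A (lift ord0 i))).
    apply: fin_bigcap_measurable => // i _.
    by rewrite -[X in measurable X]setTI; exact: measurable_tnth.
  by apply/seteqP; split => t /= h i; [move=> _|]; exact: h.
rewrite -cons_measureX//=; congr (cons_measure _ _).
apply/seteqP; split => t /=.
  move=> h; split; first exact: h.
  by move=> i; have := h (lift ord0 i); rewrite [X in tnth X _]tuple_eta tnthS.
move=> [h0 h] i; case: (unliftP ord0 i) => [j ->|->]; last exact: h0.
by rewrite [t]tuple_eta tnthS; exact: h.
Qed.

Section green.
Context {R : realType}.
Implicit Types (n : nat) (s r a : R).

(* The library's norm on ['rV[R]_n] is the sup norm, hence [enorm]. *)
Definition dotp n (x y : 'rV[R]_n) : R := \sum_(i < n) x ord0 i * y ord0 i.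

Definition enorm n (x : 'rV[R]_n) : R := Num.sqrt (dotp x x).

Definition rV_of_tuple n (t : n.-tuple R) : 'rV[R]_n := \row_i tnth t i.

Definition Gamma_integral a : R :=
  \int[lebesgue_measure]_(t in `]0, +oo[) (t `^ (a - 1) * expR (- t)).

(* For a <= 0, iterate Gamma(a) = Gamma(a + 1) / a up to the first a + k > 0;
   the value at the poles 0, -1, -2, ... is a meaningless 0. *)
Definition Gamma a : R :=
  if 0 < a then Gamma_integral a else
  let k := (Num.truncn (- a)).+1 in
  Gamma_integral (a + k%:R) / \prod_(i < k) (a + i%:R).

Definition a_const n s : R :=
  if n%:R == 2 * s then - pi^-1
  else Gamma (n%:R / 2 - s) / (2 `^ (2 * s) * pi `^ (n%:R / 2) * Gamma s).

Definition fundamental_solution n s (x : 'rV[R]_n) : R :=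
  if n%:R == 2 * s then a_const n s * ln (enorm x)
  else a_const n s * enorm x `^ (- n%:R + 2 * s).

Definition c_const n s : R :=
  Gamma (n%:R / 2) * sin (pi * s) / pi `^ (n%:R / 2 + 1).

Definition poisson_kernel n s r (y x : 'rV[R]_n) : R :=
  c_const n s * ((r ^+ 2 - enorm x ^+ 2) / (enorm y ^+ 2 - r ^+ 2)) `^ s
  * (1 / enorm (x - y) ^+ n).

(* The domain contains the null set |y| = r, on which the Poisson kernel is not
   defined mathematically; here it is 0 there since x / 0 = 0. *)
Definition green n s r (x z : 'rV[R]_n) : R :=
  fundamental_solution s (x - z) -
  \int[lebesgue_tuple R n]_(t in [set t | ~ enorm (rV_of_tuple t) < r])
    (fundamental_solution s (z - rV_of_tuple t) *
     poisson_kernel s r (rV_of_tuple t) x).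

Definition r0 n r (x z : 'rV[R]_n) : R :=
  (r ^+ 2 - enorm x ^+ 2) * (r ^+ 2 - enorm z ^+ 2)
  / (r ^+ 2 * enorm (x - z) ^+ 2).

(* In the critical case n = 2s one has n = 1, so that [dotp x z] is the product
   of the two reals x and z and [enorm] is the absolute value. *)
Definition is_green_constant n s (kappa : R) : Prop :=
  forall r (x z : 'rV[R]_n),
    0 < r -> enorm x < r -> enorm z < r -> x != z ->
    green s r x z =
    if n%:R == 2 * s then
      kappa * ln ((r ^+ 2 - dotp x z
                   + Num.sqrt ((r ^+ 2 - enorm x ^+ 2) * (r ^+ 2 - enorm z ^+ 2)))
                  / (r * enorm (z - x)))
    else
      kappa * enorm (z - x) `^ (2 * s - n%:R) *
      \int[lebesgue_measure]_(t in `[0, r0 r x z])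
        (t `^ (s - 1) / (t + 1) `^ (n%:R / 2)).

End green.

(* Main.v *)
(* Only the pole x = 0 and points z on a coordinate axis, with |z| = e -> 0, are
   needed. Since (1 - e)|y| <= |z - y| <= (1 + e)|y| for |y| >= 1, the exterior
   integral at z is comparable to the one at 0, whatever the value (finite or
   not) of the latter. For n > 2s the singular term e^(2s-n) dominates and the
   identity tends to a = kappa B(s, n/2 - s). For n = 2s both sides are
   multiples of log e up to bounded terms. For n = 1 < 2s the term e^(2s-1)
   tends to 0, but it dominates the variation O(e) of the exterior integral;
   comparing the coefficients of e^(2s-1), where the analytic continuation of
   B(s, n/2 - s) appears, gives the same equation. The Beta function is
   evaluated by Tonelli's theorem. *)
Require Import Defs.
From mathcomp Require Import all_boot all_order all_algebra.
From mathcomp Require Import all_classical all_reals all_analysis.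
From mathcomp Require Import measurable_realfun ring lra.
Set Implicit Arguments.
Unset Strict Implicit.
Unset Printing Implicit Defensive.
Import Order.TTheory GRing.Theory Num.Theory.
Import numFieldNormedType.Exports.
Local Open Scope classical_set_scope.
Local Open Scope ring_scope.

(** * Improper integrals of nonnegative functions on the half-line *)

Section half_line.
Context {R : realType}.
Implicit Types (f F : R -> R) (b c p q x : R).
Local Notation mu := (@lebesgue_measure R).

Lemma bigcup_itv_harmonic c (b : itv_bound R) : 0 < c ->
  \bigcup_k [set` Interval (BLeft (c / k.+1%:R)) b] =
  [set` Interval (BRight 0) b].
Proof.
move=> c0; apply/seteqP; split => x /=.
  move=> [k _] /=; rewrite !in_itv/= => /andP[kx ->]; rewrite andbT.
  by rewrite (lt_le_trans _ kx)// divr_gt0.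
rewrite in_itv/= => /andP[x0 xb].
exists (Num.truncn (c / x)) => //=; rewrite in_itv/= xb andbT.
rewrite ler_pdivrMr// mulrC -ler_pdivrMr//.
exact/ltW/truncnS_gt.
Qed.

(** Monotone convergence as the left endpoint decreases to 0. The free factor [c] keeps the
    endpoints below [b] in [ge0_FTC2_oc], and makes two exhaustions correspond under a dilation in
    [ge0_integral_scale]. *)
Lemma cvg_integral_harmonic f c (b : itv_bound R) : 0 < c ->
  measurable_fun [set` Interval (BRight (0 : R)) b] f ->
  (forall x, 0 < x -> 0 <= f x) ->
  (\int[mu]_(x in [set` Interval (BLeft (c / k.+1%:R)%R) b]) (f x)%:E)%E
    @[k --> \oo] -->
  (\int[mu]_(x in [set` Interval (BRight 0%R) b]) (f x)%:E)%E.
Proof.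
move=> c0 mf f0; rewrite -(@bigcup_itv_harmonic c)//.
apply: ge0_nondecreasing_set_cvg_integral => //.
- apply/nondecreasing_seqP => k; apply/subsetPset; apply: subset_itvr.
  by rewrite bnd_simp ler_pM2l// lef_pV2 ?posrE// ler_nat.
- move=> k; apply/measurable_EFinP; apply: measurable_funS mf => //.
  by rewrite -(@bigcup_itv_harmonic c)//; exact: (bigcup_sup (i := k)).
- move=> k x /=; rewrite in_itv/= => /andP[kx _].
  by rewrite lee_fin f0// (lt_le_trans _ kx)// divr_gt0.
Qed.

Lemma cvg_integral_oc_nat f :
  measurable_fun `](0 : R), +oo[ f -> (forall x, 0 < x -> 0 <= f x) ->
  (\int[mu]_(x in `]0%R, (k%:R : R)]) (f x)%:E)%E @[k --> \oo] -->
  (\int[mu]_(x in `]0%R, +oo[) (f x)%:E)%E.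
Proof.
move=> mf f0.
have -> : `](0 : R), +oo[%classic = \bigcup_k `]0, (k%:R : R)]%classic.
  apply/seteqP; split => x /=.
    rewrite in_itv/= andbT => x0; exists (Num.truncn x).+1 => //=.
    by rewrite in_itv/= x0; exact/ltW/truncnS_gt.
  by move=> [k _] /=; rewrite !in_itv/= andbT => /andP[].
apply: ge0_nondecreasing_set_cvg_integral => //.
- apply/nondecreasing_seqP => k; apply/subsetPset; apply: subset_itvl.
  by rewrite bnd_simp ler_nat.
- move=> k; apply/measurable_EFinP; apply: measurable_funS mf => //.
  by apply: subset_itvl.
- by move=> k x /=; rewrite in_itv/= => /andP[x0 _]; rewrite lee_fin f0.
Qed.

Lemma continuous_gt0_measurable f (b : itv_bound R) :
  (forall x, 0 < x -> {for x, continuous f}) ->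
  measurable_fun [set` Interval (BRight (0 : R)) b] f.
Proof.
move=> cf; apply: (@measurable_funS _ _ _ _ `](0 : R), +oo[) => //.
  apply: subset_itvl; by case: b => [? ?|[]].
apply: open_continuous_measurable_fun => //.
by move=> x; rewrite inE/= in_itv/= andbT; exact: cf.
Qed.

Lemma is_derive_derivable_oo F f :
  (forall x, 0 < x -> is_derive x 1 F (f x)) ->
  forall x, 0 < x -> {for x, continuous F}.
Proof.
move=> dF x x0; apply: differentiable_continuous; apply/derivable1_diffP.
by have [] := dF _ x0.
Qed.

(* The integrand may be unbounded at [0], hence the exhaustion by closed
   intervals. *)
Lemma ge0_FTC2_oc F f b : 0 < b ->
  (forall x, 0 < x -> is_derive x 1 F (f x)) ->
  (forall x, 0 < x -> {for x, continuous f}) ->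
  (forall x, 0 < x -> 0 <= f x) ->
  F x @[x --> 0^'+] --> F 0 ->
  (\int[mu]_(x in `]0%R, b]) (f x)%:E)%E = (F b - F 0)%:E.
Proof.
move=> b0 dF cf f0 F0.
have cF := @is_derive_derivable_oo _ _ dF.
have b20 : 0 < b / 2 by rewrite divr_gt0.
have h := @cvg_integral_harmonic f _ _ b20 (@continuous_gt0_measurable f (BRight b) cf) f0.
apply: (cvg_unique _ h) => //=.
have kE k : (\int[mu]_(x in `[(b / 2 / k.+1%:R)%R, b]) (f x)%:E)%E =
    (F b - F (b / 2 / k.+1%:R))%:E.
  have k0 : 0 < b / 2 / k.+1%:R by rewrite divr_gt0.
  have kb : b / 2 / k.+1%:R < b.
    rewrite ltr_pdivrMr//; have : 1 <= k.+1%:R :> R by rewrite ler1n.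
    nra.
  rewrite (@continuous_FTC2 _ _ F)//.
  - apply: continuous_in_subspaceT => x; rewrite inE/= in_itv/= => /andP[kx _].
    by apply: cf; exact: lt_le_trans kx.
  - split.
    + move=> x; rewrite in_itv/= => /andP[kx _].
      by have [] := dF _ (lt_trans k0 kx).
    + by apply: cvg_at_right_filter; exact: cF.
    + by apply: cvg_at_left_filter; exact: cF.
  - move=> x; rewrite in_itv/= => /andP[kx _].
    by rewrite derive1E; have [_ ->] := dF _ (lt_trans k0 kx).
under eq_fun do rewrite kE.
apply: cvg_EFin; first by near=> k.
apply: cvgB; first exact: cvg_cst.
move/cvg_at_rightP : F0; apply; split=> [k|]; first by rewrite divr_gt0.
rewrite -(mulr0 (b / 2)); apply: cvgMr; exact: cvg_harmonic.
Unshelve. all: by end_near. Qed.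

Lemma ge0_FTC2_oy F f l :
  (forall x, 0 < x -> is_derive x 1 F (f x)) ->
  (forall x, 0 < x -> {for x, continuous f}) ->
  (forall x, 0 < x -> 0 <= f x) ->
  F x @[x --> 0^'+] --> F 0 -> F x @[x --> +oo] --> l ->
  (\int[mu]_(x in `]0%R, +oo[) (f x)%:E)%E = (l - F 0)%:E.
Proof.
move=> dF cf f0 F0 Fl.
have h := @cvg_integral_oc_nat f (@continuous_gt0_measurable f _ cf) f0.
apply: (cvg_unique _ h) => //=.
apply: (@cvg_trans _ ((F k%:R - F 0)%:E @[k --> \oo])).
  apply: near_eq_cvg; near=> k; rewrite (@ge0_FTC2_oc F)// ltr0n.
  by near: k; exact: nbhs_infty_gt.
apply: cvg_EFin; first by near=> k.
apply: cvgB; last exact: cvg_cst.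
by apply: (cvg_comp (fun k => k%:R) F); [exact: cvgr_idn|exact: Fl].
Unshelve. all: by end_near. Qed.

(** Substitution is applied on the closed half-lines starting at [1 / k.+1], away from a possible
    singularity at 0. The dilation maps them onto those starting at [c / k.+1], and both families
    exhaust the open half-line. *)
Lemma ge0_integral_scale f c : 0 < c ->
  (forall x, 0 < x -> {for x, continuous f}) ->
  (forall x, 0 < x -> 0 <= f x) ->
  (\int[mu]_(x in `]0%R, +oo[) (f (c * x) * c)%:E =
   \int[mu]_(x in `]0%R, +oo[) (f x)%:E)%E.
Proof.
move=> c0 cf f0.
have cmul : continuous (fun x => c * x) by move=> x; exact: mulrl_continuous.
have cg x : 0 < x -> {for x, continuous (fun x => f (c * x) * c)}.
  move=> x0; apply: cvgM; last exact: cvg_cst.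
  by apply: (@continuous_comp _ _ _ ( *%R c) f); [exact: cmul|apply: cf; rewrite mulr_gt0].
have g0 x : 0 < x -> 0 <= f (c * x) * c.
  by move=> x0; rewrite mulr_ge0 ?(ltW c0)// f0// mulr_gt0.
have h1 := @cvg_integral_harmonic f _ _ c0 (@continuous_gt0_measurable f +oo%O cf) f0.
have h2 := @cvg_integral_harmonic _ _ _ ltr01 (@continuous_gt0_measurable _ +oo%O cg) g0.
apply: (cvg_unique _ h2) => //=.
rewrite (_ : (fun k => _) = (fun k =>
   \int[mu]_(x in [set` Interval (BLeft (c / k.+1%:R)%R) +oo%O]) (f x)%:E)%E); first exact: h1.
apply/funext => k.
have dc : derive1 ( *%R c) = cst c.
  by apply/funext => x; rewrite derive1E (_ : *%R c = c \*: id)// derive_val /cst /= [LHS]mulr1.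
have k0 : 0 < (k.+1%:R : R)^-1 by rewrite invr_gt0.
rewrite -[in RHS](div1r k.+1%:R).
rewrite (_ : c * (1 / k.+1%:R) = (fun x => c * x) (1 / k.+1%:R))//.
rewrite (@increasing_ge0_integration_by_substitutiony _ ( *%R c))//.
- by apply: eq_integral => x _; rewrite dc.
- by move=> x y _ _; rewrite ltr_pM2l.
- by rewrite dc => x _; exact: cst_continuous.
- by rewrite dc; exact: is_cvg_cst.
- by rewrite dc; exact: is_cvg_cst.
- split=> [x _|]; first exact: derivableM.
  exact/cvg_at_right_filter/cmul.
- exact: gt0_cvgMry.
- apply: continuous_in_subspaceT => x; rewrite inE/= in_itv/= andbT => kx.
  by apply: cf; apply: lt_le_trans kx; rewrite mulr_gt0// divr_gt0.
- move=> x; rewrite in_itv/= andbT => kx; apply/f0/lt_trans/kx.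
  by rewrite mulr_gt0// divr_gt0.
Qed.

(** * Powers, their growth, and the Beta integrand *)

Lemma continuous_powR p x : 0 < x -> {for x, continuous (@powR R ^~ p)}.
Proof.
move=> x0; apply: differentiable_continuous; apply/derivable1_diffP.
by have [] := is_derive1_powR p x0.
Qed.

Lemma continuous_powR1D p x : 0 <= x ->
  {for x, continuous (fun t : R => (t + 1) `^ p)}.
Proof.
move=> x0; apply: (@continuous_comp _ _ _ (fun t : R => t + 1) (@powR R ^~ p)).
  by apply: cvgD; [exact: cvg_id|exact: cvg_cst].
by apply: continuous_powR; rewrite ltr_wpDl.
Qed.

Lemma is_derive_powR1D p x : 0 < x ->
  is_derive x 1 (fun t : R => (t + 1) `^ p) (p * (x + 1) `^ (p - 1)).
Proof.
move=> x0; have x1 : 0 < x + 1 by rewrite addr_gt0.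
have := is_derive1_powR p x1 => dp.
have d1 : is_derive x 1 (fun t : R => t + 1) 1.
  by rewrite -[X in is_derive _ _ _ X]addr0; exact: is_deriveD.
rewrite -[X in is_derive _ _ _ X]mulr1.
exact: (@is_derive1_comp _ (@powR R ^~ p) (fun t : R => t + 1)).
Qed.

Lemma powRV p x : 0 < x -> x^-1 `^ p = x `^ (- p).
Proof. by move=> x0; rewrite -powR_inv1 ?ltW// -powRrM mulN1r. Qed.

Lemma cvgyD1 : x + 1 @[x --> (+oo : set_system R)] --> +oo.
Proof.
apply/cvgryPge => A; near=> x; rewrite -lerBlDr; near: x.
by apply: nbhs_pinfty_ge; exact: num_real.
Unshelve. all: by end_near. Qed.

Lemma powR_cvgy p : 0 < p -> x `^ p @[x --> +oo] --> +oo.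
Proof.
move=> p0; apply/cvgryPge => A; near=> x.
have Ax : `|A| `^ p^-1 <= x.
  by near: x; apply: nbhs_pinfty_ge; exact: num_real.
rewrite (le_trans (ler_norm A))// -[leLHS]powRr1// -(@mulVf _ p) ?gt_eqF//.
by rewrite powRrM ge0_ler_powR ?nnegrE ?powR_ge0// ?ltW// (le_trans _ Ax)// powR_ge0.
Unshelve. all: by end_near. Qed.

Lemma powRN_cvgy p : 0 < p -> x `^ (- p) @[x --> +oo] --> 0.
Proof.
move=> p0; under eq_fun do rewrite powRN.
apply/gtr0_cvgV0; last exact: powR_cvgy.
by near=> x; rewrite powR_gt0.
Unshelve. all: by end_near. Qed.

(** This is the bound ln u <= u - 1 at u = (x + 1) / p, multiplied by p. The constant is the value
    of (x + 1)^p e^(-x) at x + 1 = p. *)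
Lemma powR1D_le_expR p x : 0 < p -> 0 <= x ->
  (x + 1) `^ p <= expR (p * ln p + 1 - p) * expR x.
Proof.
move=> p0 x0; have x1 : 0 < x + 1 by rewrite ltr_wpDl.
rewrite /powR gt_eqF// -expRD ler_expR.
have := @le_ln1Dx R ((x + 1) / p - 1).
rewrite subrKC ln_div ?posrE// => h.
have : ln (x + 1) - ln p <= (x + 1) / p - 1.
  by apply: h; rewrite ltrBrDl subrr divr_gt0.
rewrite -(ler_pM2l p0) !mulrBr mulrCA divff ?gt_eqF//; lra.
Qed.

(** For m = n/2 this is the integrand of the Green formula; for 0 < s < m its integral over the
    half-line is the Beta value B(s, m - s). *)
Definition beta_integrand s m x : R := x `^ (s - 1) / (x + 1) `^ m.

Lemma beta_integrand_ge0 s m x : 0 <= beta_integrand s m x.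
Proof. by rewrite divr_ge0 ?powR_ge0. Qed.

Lemma continuous_beta_integrand s m x : 0 < x ->
  {for x, continuous (beta_integrand s m)}.
Proof.
move=> x0; apply: cvgM; first exact: continuous_powR.
apply: cvgV; last by apply: continuous_powR1D; exact: ltW.
by rewrite gt_eqF// powR_gt0 ?addr_gt0.
Qed.

Lemma measurable_beta_integrand s m (b : itv_bound R) :
  measurable_fun [set` Interval (BRight (0 : R)) b] (beta_integrand s m).
Proof.
apply: (@continuous_gt0_measurable (beta_integrand s m)).
exact: continuous_beta_integrand.
Qed.

Definition powR_ratio s m x : R := x `^ s * (x + 1) `^ (- m).

(** After factoring out x^(s-1) (x+1)^(-m-1), the product rule leaves s (x + 1) - m x, which equals
    (s - m)(x + 1) + m. *)
Lemma is_derive_powR_ratio s m x : 0 < s -> 0 < x ->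
  is_derive x 1 (powR_ratio s m)
    ((s - m) * beta_integrand s m x + m * beta_integrand s (m + 1) x).
Proof.
move=> s0 x0.
have d1 := is_derive1_powR s x0; have d2 := @is_derive_powR1D (- m) x x0.
apply: is_derive_eq; have x1 : 0 < x + 1 by rewrite addr_gt0.
rewrite /beta_integrand -!powRN opprD.
have -> : x `^ s = x * x `^ (s - 1) by rewrite mulr_powRB1// ltW.
have -> : (x + 1) `^ (- m) = (x + 1) * (x + 1) `^ (- m - 1).
  rewrite -[X in _ = X * _](powRr1 (ltW x1)) -powRD.
    by congr powR; ring.
  by rewrite (gt_eqF x1) implybT.
rewrite /GRing.scale/=; ring.
Qed.

Lemma cvg_powR_ratio0 s m : 0 < s ->
  powR_ratio s m x @[x --> 0^'+] --> powR_ratio s m 0.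
Proof.
move=> s0; rewrite /powR_ratio powR0 ?gt_eqF//; apply: cvgM.
  exact: powR_cvg0.
by apply: cvg_at_right_filter; exact: continuous_powR1D.
Qed.

Lemma cvg_powR_ratioy p : powR_ratio p p x @[x --> +oo] --> (1 : R).
Proof.
have FE : {near +oo, (fun x => (1 - (x + 1)^-1) `^ p) =1 powR_ratio p p}.
  near=> x; have x0 : 0 < x by near: x; exact: nbhs_pinfty_gt.
  have x1 : 0 < x + 1 by rewrite addr_gt0.
  rewrite /powR_ratio -powRV// -powRM ?invr_ge0 ?ltW//; congr powR; field.
  by rewrite gt_eqF.
apply: cvg_trans (near_eq_cvg FE) _.
suff : (1 - (x + 1)^-1) `^ p @[x --> +oo] --> (1 - 0 : R) `^ p.
  by rewrite subr0 powR1.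
apply: (@cvg_comp _ _ _ _ (@powR R ^~ p)); last first.
  by apply: continuous_powR; rewrite subr0.
apply: cvgB; first exact: cvg_cst.
apply/gtr0_cvgV0; first by near=> x; rewrite addr_gt0.
exact: cvgyD1.
Unshelve. all: by end_near. Qed.

(** The primitive is (x / (x + 1))^p, which rises from 0 to 1. The integrand serves as majorant of
    the Gamma integrand. *)
Lemma integral_beta_integrand_diag p : 0 < p ->
  (\int[mu]_(x in `]0%R, +oo[) (p * beta_integrand p (p + 1) x)%:E)%E = 1%E.
Proof.
move=> p0; transitivity (1 - powR_ratio p p 0)%:E; last first.
  by rewrite /powR_ratio powR0 ?gt_eqF// mul0r subr0.
apply: ge0_FTC2_oy.
- move=> x x0; have := @is_derive_powR_ratio p p x p0 x0.
  by rewrite subrr mul0r add0r.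
- move=> x x0; apply: cvgM; first exact: cvg_cst.
  exact: continuous_beta_integrand.
- by move=> x _; rewrite mulr_ge0 ?beta_integrand_ge0// ltW.
- exact: cvg_powR_ratio0.
- exact: cvg_powR_ratioy.
Qed.

End half_line.

(** * The Gamma and Beta functions *)

Section gamma_beta.
Context {R : realType}.
Implicit Types (f F : R -> R) (b c p q s m x : R).
Local Notation mu := (@lebesgue_measure R).

Definition gamma_integrand p x : R := x `^ (p - 1) * expR (- x).

Lemma gamma_integrand_ge0 p x : 0 <= gamma_integrand p x.
Proof. by rewrite mulr_ge0 ?powR_ge0 ?expR_ge0. Qed.

Lemma continuous_gamma_integrand p x : 0 < x ->
  {for x, continuous (gamma_integrand p)}.
Proof.
move=> x0; apply: cvgM; first exact: continuous_powR.
apply: (@continuous_comp _ _ _ (@GRing.opp R) expR); last exact: continuous_expR.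
exact: opp_continuous.
Qed.

(** The content is finiteness, since [Gamma] is a real integral that would read an infinite one as
    0. By [powR1D_le_expR] at exponent p + 1, e^(-x) <= K (x + 1)^(-p-1), so a multiple of the Beta
    integrand with finite integral dominates. *)
Lemma integral_gamma_integrand p : 0 < p ->
  (\int[mu]_(x in `]0%R, +oo[) (gamma_integrand p x)%:E)%E = (Gamma p)%:E.
Proof.
move=> p0; rewrite /Gamma p0 /Gamma_integral /Rintegral fineK//.
have p10 : 0 < p + 1 by rewrite addr_gt0.
pose K := expR ((p + 1) * ln (p + 1) + 1 - (p + 1)).
rewrite ge0_fin_numE; last first.
  by apply: integral_ge0 => x _; rewrite lee_fin gamma_integrand_ge0.
pose h x : R := p * beta_integrand p (p + 1) x.
have h0 x : 0 <= h x by rewrite mulr_ge0 ?beta_integrand_ge0// ltW.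
have mh : measurable_fun `](0 : R), +oo[ h.
  by apply: measurable_funM => //; exact: measurable_beta_integrand.
apply: (@le_lt_trans _ _ (\int[mu]_(x in `]0%R, +oo[) ((K / p)%:E * (h x)%:E))%E).
  apply: ge0_le_integral => //.
  - by move=> x _; rewrite lee_fin gamma_integrand_ge0.
  - apply/measurable_EFinP; apply: (@continuous_gt0_measurable _ (gamma_integrand p)).
    exact: continuous_gamma_integrand.
  - by apply/measurable_EFinP; exact: measurable_funM.
  - move=> x /=; rewrite in_itv/= andbT => x0; rewrite -EFinM lee_fin.
    have -> : K / p * h x = x `^ (p - 1) * (K * (x + 1) `^ (- (p + 1))).
      by rewrite /h /beta_integrand powRN; field; rewrite !gt_eqF ?powR_gt0 ?addr_gt0.
    rewrite ler_wpM2l ?powR_ge0// expRN.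
    rewrite powRN -ler_pdivrMr ?invr_gt0 ?powR_gt0 ?addr_gt0// invrK mulrC.
    by rewrite ler_pdivrMr ?expR_gt0// powR1D_le_expR// ltW.
rewrite ge0_integralZl//.
- by rewrite integral_beta_integrand_diag// mule1 ltry.
- exact/measurable_EFinP.
- by move=> x _; rewrite lee_fin.
- by rewrite lee_fin divr_ge0 ?expR_ge0// ltW.
Qed.

Lemma Gamma_ge0 p : 0 < p -> 0 <= Gamma p.
Proof.
move=> p0; rewrite -lee_fin -integral_gamma_integrand//.
by apply: integral_ge0 => x _; rewrite lee_fin gamma_integrand_ge0.
Qed.

Lemma integral_gamma_integrand_scale p c : 0 < p -> 0 < c ->
  (\int[mu]_(x in `]0%R, +oo[) (x `^ (p - 1) * expR (- (c * x)))%:E)%E =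
  (c `^ (- p) * Gamma p)%:E.
Proof.
move=> p0 c0.
rewrite EFinM -integral_gamma_integrand// -(@ge0_integral_scale _ _ c)//; last 2 first.
- exact: continuous_gamma_integrand.
- by move=> x _; exact: gamma_integrand_ge0.
rewrite -ge0_integralZl//; last 3 first.
- apply/measurable_EFinP/measurable_funM => //.
  apply: (@continuous_gt0_measurable _ (fun x => gamma_integrand p (c * x))) => x x0.
  apply: (@continuous_comp _ _ _ ( *%R c) (gamma_integrand p)).
    exact: mulrl_continuous.
  by apply: continuous_gamma_integrand; rewrite mulr_gt0.
- by move=> x _; rewrite lee_fin mulr_ge0 ?gamma_integrand_ge0// ltW.
- by rewrite lee_fin powR_ge0.
apply: eq_integral => x; rewrite inE/= in_itv/= andbT => x0.
rewrite -EFinM; congr EFin; rewrite /gamma_integrand powRM ?ltW//.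
have -> : c `^ (- p) = (c * c `^ (p - 1))^-1 by rewrite mulr_powRB1 ?ltW// powRN.
by field; rewrite !gt_eqF ?powR_gt0.
Qed.

Lemma Gamma1 : Gamma 1 = 1 :> R.
Proof.
pose F (x : R) := - expR (- x).
suff [->] : (Gamma 1)%:E = (0 - F 0)%:E by rewrite /F oppr0 expR0 opprK add0r.
rewrite -integral_gamma_integrand//.
have oc : continuous (fun x : R => expR (- x)).
  by move=> x; apply: (@continuous_comp _ _ _ (@GRing.opp R) expR);
    [exact: opp_continuous|exact: continuous_expR].
apply: (@ge0_FTC2_oy _ F).
- move=> x _; rewrite /gamma_integrand subrr powRr0 mul1r.
  rewrite -[X in is_derive _ _ _ X]opprK; apply: is_deriveN.
  rewrite -mulrN1; exact: (@is_derive1_comp _ expR (@GRing.opp R)).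
- exact: continuous_gamma_integrand.
- by move=> x _; exact: gamma_integrand_ge0.
- by apply: cvg_at_right_filter; apply: cvgN; exact: oc.
- by rewrite -oppr0; apply: cvgN; exact: cvgr_expR.
Qed.

Lemma Gamma_gt0 p : 0 < p -> 0 < Gamma p.
Proof.
move=> p0; rewrite -lte_fin -integral_gamma_integrand//.
have mg : measurable_fun `](0 : R), +oo[ (gamma_integrand p).
  apply: (@continuous_gt0_measurable _ (gamma_integrand p)).
  exact: continuous_gamma_integrand.
have sub : `[(1 : R), 2] `<=` `](0 : R), +oo[.
  move=> x /=; rewrite !in_itv/= andbT => /andP[x1 _].
  exact: lt_le_trans x1.
(* On [1, 2] one has e^(-x) >= e^(-2) and, because p - 1 >= -1, x^(p-1) >= 1/x >= 1/2. *)
apply: (@lt_le_trans _ _ (\int[mu]_(x in `[1%R, 2%R]) (expR (- 2) / 2)%:E)%E).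
  rewrite integral_cst//= lebesgue_measure_itv/= lte_fin ltr1n/= -EFinD -EFinM.
  by rewrite lte_fin mulr_gt0 ?divr_gt0 ?expR_gt0// subr_gt0 ltr1n.
apply: (@le_trans _ _ (\int[mu]_(x in `[1%R, 2%R]) (gamma_integrand p x)%:E)%E).
  apply: ge0_le_integral => //.
    by apply/measurable_EFinP; exact: measurable_funS mg.
  move=> x /=; rewrite in_itv/= => /andP[x1 x2].
  have x0 : 0 < x by rewrite (lt_le_trans _ x1).
  rewrite lee_fin mulrC /gamma_integrand ler_pM ?invr_ge0 ?expR_ge0 ?ler_expR ?lerN2//.
  apply: (@le_trans _ _ x^-1); first by rewrite lef_pV2// posrE.
  by rewrite -(powR_inv1 (ltW x0)) ler_powR// lerBrDl addrN ltW.
apply: ge0_subset_integral => //; first exact/measurable_EFinP.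
by move=> x _; rewrite lee_fin gamma_integrand_ge0.
Qed.

(** Moves the half-line into the integrand, so that Tonelli's theorem can be used on the whole
    plane. *)
Lemma integral_indicM (D : set R) f : measurable D ->
  (\int[mu]_x (\1_D x * f x)%:E = \int[mu]_(x in D) (f x)%:E)%E.
Proof.
move=> mD; rewrite [in RHS]integral_mkcond; apply: eq_integral => x _.
by rewrite patchE indicE; case: ifP => _; rewrite ?mul1r ?mul0r.
Qed.

(** Tonelli for t^(p-1) u^(p+q-1) e^(-(t+1)u) on the quadrant. Integrating in u first gives
    Gamma(p+q) times the Beta integrand in t; integrating in t first gives Gamma(p) times the Gamma
    integrand of exponent q in u. *)
Lemma beta_integral p q : 0 < p -> 0 < q ->
  (\int[mu]_(x in `]0%R, +oo[) (beta_integrand p (p + q) x)%:E)%E =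
  (Gamma p * Gamma q / Gamma (p + q))%:E.
Proof.
move=> p0 q0; have pq0 : 0 < p + q by rewrite addr_gt0.
pose D : set R := `]0, +oo[%classic.
have mD : measurable D by exact: measurable_itv.
pose g (t u : R) := t `^ (p - 1) * (u `^ (p + q - 1) * expR (- ((t + 1) * u))).
have g0 t u : 0 <= g t u by rewrite !mulr_ge0 ?powR_ge0 ?expR_ge0.
pose h (z : R * R) : \bar R := (\1_D z.1 * (\1_D z.2 * g z.1 z.2))%:E.
have h0 z : (0 <= h z)%E.
  by rewrite lee_fin !indicE; apply: mulr_ge0 => //; exact: mulr_ge0.
have mh : measurable_fun setT h.
  apply/measurable_EFinP; apply: measurable_funM.
    by apply: measurableT_comp => //; exact: measurable_indic.
  apply: measurable_funM.
    by apply: measurableT_comp => //; exact: measurable_indic.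
  apply: measurable_funM.
    by apply: (measurableT_comp (measurable_powR _)).
  apply: measurable_funM.
    by apply: (measurableT_comp (measurable_powR _)).
  apply: measurableT_comp => //; apply: measurableT_comp => //.
  by apply: measurable_funM => //; exact: measurable_funD.
have E1 : (\int[mu]_t \int[mu]_u h (t, u) = (Gamma (p + q))%:E *
    \int[mu]_(x in `]0%R, +oo[) (beta_integrand p (p + q) x)%:E)%E.
  rewrite -ge0_integralZl//=; last 3 first.
  - by apply/measurable_EFinP; exact: measurable_beta_integrand.
  - by move=> x _; rewrite lee_fin beta_integrand_ge0.
  - by rewrite lee_fin Gamma_ge0.
  rewrite [RHS]integral_mkcond; apply: eq_integral => t _.
  rewrite patchE /h/= indicE; case: ifPn => tD; last first.
    by under eq_integral do rewrite mul0r; rewrite integral0.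
  under eq_integral do rewrite mul1r.
  rewrite integral_indicM//.
  move: tD; rewrite inE/= in_itv/= andbT => t0.
  have t10 : 0 < t + 1 by rewrite addr_gt0.
  under eq_integral do rewrite EFinM.
  rewrite ge0_integralZl//; last 3 first.
  - apply/measurable_EFinP; apply: measurable_funTS; apply: measurable_funM => //.
    by apply: measurableT_comp => //; apply: measurableT_comp => //; exact: measurable_funM.
  - by move=> x _; rewrite lee_fin mulr_ge0 ?powR_ge0 ?expR_ge0.
  - by rewrite lee_fin powR_ge0.
  rewrite integral_gamma_integrand_scale// -!EFinM; congr EFin.
  by rewrite /beta_integrand powRN; ring.
have E2 : (\int[mu]_u \int[mu]_t h (t, u) = (Gamma p)%:E * (Gamma q)%:E)%E.
  rewrite -(integral_gamma_integrand q0) -ge0_integralZl//=; last 3 first.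
  - apply/measurable_EFinP; apply: (@continuous_gt0_measurable _ (gamma_integrand q)).
    exact: continuous_gamma_integrand.
  - by move=> x _; rewrite lee_fin gamma_integrand_ge0.
  - by rewrite lee_fin Gamma_ge0.
  rewrite [RHS]integral_mkcond; apply: eq_integral => u _.
  rewrite patchE /h/= integral_indicM// indicE; case: ifPn => uD; last first.
    by under eq_integral do rewrite mul0r; rewrite integral0.
  under eq_integral do rewrite mul1r.
  move: uD; rewrite inE/= in_itv/= andbT => u0.
  have gE t : g t u = u `^ (p + q - 1) * expR (- u) * (t `^ (p - 1) * expR (- (u * t))).
    by rewrite /g mulrDl mul1r opprD expRD (mulrC u t); ring.
  under eq_integral do rewrite gE EFinM.
  rewrite ge0_integralZl//; last 3 first.
  - apply/measurable_EFinP; apply: measurable_funTS; apply: measurable_funM => //.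
    by apply: measurableT_comp => //; apply: measurableT_comp => //; exact: measurable_funM.
  - by move=> x _; rewrite lee_fin mulr_ge0 ?powR_ge0 ?expR_ge0.
  - by rewrite lee_fin mulr_ge0 ?powR_ge0 ?expR_ge0.
  rewrite integral_gamma_integrand_scale// -!EFinM; congr EFin.
  rewrite /gamma_integrand (_ : p + q - 1 = p + (q - 1)); last ring.
  rewrite powRD; last by rewrite (gt_eqF u0) implybT.
  by rewrite powRN; field; rewrite gt_eqF// powR_gt0.
have := fubini_tonelli (m1 := mu) (m2 := mu) h mh h0; rewrite E1 E2.
have Gpq := Gamma_gt0 pq0.
(* The Beta integral is not yet known to be finite, so the finite nonzero factor Gamma(p+q) is
   cancelled in the extended reals. *)
move=> /(congr1 (fun y : \bar R => (Gamma (p + q))^-1%:E * y)%E).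
rewrite muleA -!EFinM mulVf ?gt_eqF// mul1e => ->; congr EFin; ring.
Qed.

(** The Beta integral B(1, p) is elementary: its integrand (x + 1)^(-1-p) has primitive -(x +
    1)^(-p) / p, so it equals 1/p. Comparison with [beta_integral] and Gamma(1) = 1 gives the
    recurrence. *)
Lemma GammaD1 p : 0 < p -> Gamma (p + 1) = p * Gamma p.
Proof.
move=> p0; have := beta_integral ltr01 p0.
pose F (x : R) := (x + 1) `^ (- p) * (- p^-1).
have -> : (\int[mu]_(x in `]0%R, +oo[) (beta_integrand 1 (1 + p) x)%:E
    = (0 - F 0)%:E)%E.
  apply: (@ge0_FTC2_oy _ F).
  - move=> x x0; have d := is_derive_powR1D (- p) x0.
    apply: is_derive_eq; rewrite /beta_integrand.
    rewrite subrr powRr0 -powRN (_ : - (1 + p) = - p - 1); last ring.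
    by rewrite /GRing.scale/=; field; rewrite gt_eqF.
  - exact: continuous_beta_integrand.
  - by move=> x _; exact: beta_integrand_ge0.
  - apply: cvg_at_right_filter; apply: cvgM; last exact: cvg_cst.
    exact: continuous_powR1D.
  - rewrite -(mul0r (- p^-1)); apply: cvgM; last exact: cvg_cst.
    apply: (@cvg_comp _ _ _ (fun x : R => x + 1) (@powR R ^~ (- p))).
      exact: cvgyD1.
    exact: powRN_cvgy.
rewrite /F sub0r add0r powR1 Gamma1 !mul1r opprK => -[pG].
rewrite (addrC p).
have Gp : 0 < Gamma (1 + p) by rewrite Gamma_gt0// addr_gt0.
have -> : Gamma p = p^-1 * Gamma (1 + p).
  by rewrite pG divfK// gt_eqF.
by rewrite mulVKf// gt_eqF.
Qed.

(** * Incomplete Beta integrals, the right-hand side of the Green formula *)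

Definition incomplete_beta s m b : R :=
  \int[mu]_(t in `[0, b]) beta_integrand s m t.

(** The endpoint 0 is a null set, and the integral is finite because x^(s-1), integrable at 0 for s
    > 0, is a majorant. *)
Lemma incomplete_betaE s m b : 0 < s -> 0 <= m -> 0 < b ->
  (\int[mu]_(x in `]0%R, b]) (beta_integrand s m x)%:E)%E =
  (incomplete_beta s m b)%:E.
Proof.
move=> s0 m0 b0.
rewrite /incomplete_beta /Rintegral.
rewrite -integral_itv_obnd_cbnd; last first.
  by apply/measurable_EFinP; exact: measurable_beta_integrand.
rewrite fineK// ge0_fin_numE; last first.
  by apply: integral_ge0 => x _; rewrite lee_fin beta_integrand_ge0.
pose F x := s^-1 * x `^ s.
apply: (@le_lt_trans _ _ (F b - F 0)%:E); last by rewrite ltry.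
have cp x : 0 < x -> {for x, continuous (fun x : R => x `^ (s - 1))}.
  exact: continuous_powR.
have <- : (\int[mu]_(x in `]0%R, b]) (x `^ (s - 1))%:E)%E = (F b - F 0)%:E.
  apply: (@ge0_FTC2_oc _ F) => //.
  - move=> x x0; have d := is_derive1_powR s x0.
    apply: is_derive_eq.
    by rewrite /GRing.scale/=; field; rewrite gt_eqF.
  - by move=> x _; rewrite powR_ge0.
  - rewrite /F powR0 ?gt_eqF//; apply: cvgM; first exact: cvg_cst.
    exact: powR_cvg0.
apply: ge0_le_integral => //.
- by move=> x _; rewrite lee_fin beta_integrand_ge0.
- by apply/measurable_EFinP; exact: measurable_beta_integrand.
- apply/measurable_EFinP; exact: (@continuous_gt0_measurable _ (fun x : R => x `^ (s - 1))).
- move=> x /=; rewrite in_itv/= => /andP[x0 _].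
  rewrite lee_fin ler_pdivrMr ?powR_gt0 ?addr_gt0//.
  rewrite -[leLHS]mulr1 ler_wpM2l ?powR_ge0//.
  rewrite -[leLHS](powRr0 (x + 1)) ler_powR// lerDr; exact: ltW.
Qed.

Lemma cvg_incomplete_beta s m : 0 < s -> s < m ->
  incomplete_beta s m k%:R @[k --> \oo] --> Gamma s * Gamma (m - s) / Gamma m.
Proof.
move=> s0 sm; have ms0 : 0 < m - s by rewrite subr_gt0.
have := beta_integral s0 ms0; rewrite subrKC => hb.
have := @cvg_integral_oc_nat _ (beta_integrand s m)
  (@measurable_beta_integrand _ s m +oo%O) (fun x _ => beta_integrand_ge0 s m x).
rewrite hb => /fine_cvg; apply: cvg_trans; apply: near_eq_cvg.
near=> k; rewrite /= incomplete_betaE//.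
  by rewrite ltW// (lt_trans s0).
by rewrite ltr0n; near: k; exact: nbhs_infty_gt.
Unshelve. all: by end_near. Qed.

(* Integrating the derivative of [x^s (x + 1)^-m] lowers the exponent [m + 1],
   for which the integral converges at infinity, to [m]. *)
Lemma incomplete_beta_rec s m b : 0 < m -> m <= s -> 0 < b ->
  (s - m) * incomplete_beta s m b + m * incomplete_beta s (m + 1) b =
  b `^ s * (b + 1) `^ (- m).
Proof.
move=> m0 ms b0; have s0 : 0 < s by exact: lt_le_trans ms.
have sm0 : 0 <= s - m by rewrite subr_ge0.
have m10 : 0 <= m + 1 by rewrite addr_ge0// ltW.
pose F := powR_ratio s m.
suff : ((s - m)%:E * (incomplete_beta s m b)%:E +
        m%:E * (incomplete_beta s (m + 1) b)%:E)%E = (F b - F 0)%:E.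
  by rewrite /F /powR_ratio powR0 ?gt_eqF// mul0r subr0 => -[].
rewrite -!incomplete_betaE ?(ltW m0)//.
(* The two terms of the derivative of [powR_ratio]. The hypothesis m <= s makes both nonnegative, so
   additivity and the fundamental theorem apply in nonnegative form. *)
pose f i : R -> R := fun x => (if i is 0%N then s - m else m) * beta_integrand s (m + i%:R) x.
have f0 i x : 0 <= f i x by rewrite mulr_ge0 ?beta_integrand_ge0//; case: i => // _; exact: ltW.
have mf i : measurable_fun `](0 : R), b] (f i).
  by apply: measurable_funM => //; exact: measurable_beta_integrand.
transitivity (\int[mu]_(x in `]0%R, b]) ((f 0%N x)%:E + (f 1%N x)%:E))%E.
  rewrite ge0_integralD//; last 4 first.
  - by move=> x _; rewrite lee_fin.
  - by apply/measurable_EFinP; exact: mf.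
  - by move=> x _; rewrite lee_fin.
  - by apply/measurable_EFinP; exact: mf.
  congr (_ + _)%E.
    rewrite -ge0_integralZl//; last 2 first.
    - by apply/measurable_EFinP; exact: measurable_beta_integrand.
    - by move=> x _; rewrite lee_fin beta_integrand_ge0.
    by apply: eq_integral => x _; rewrite /f addr0.
  rewrite -ge0_integralZl//.
  - by apply/measurable_EFinP; exact: measurable_beta_integrand.
  - by move=> x _; rewrite lee_fin beta_integrand_ge0.
  - by rewrite lee_fin ltW.
apply: (@ge0_FTC2_oc _ F (fun x => f 0%N x + f 1%N x)) => //.
- by move=> x x0; rewrite /f/= addr0; exact: is_derive_powR_ratio.
- move=> x x0; apply: cvgD; (apply: cvgM; first exact: cvg_cst);
    exact: continuous_beta_integrand.
- by move=> x _; rewrite addr_ge0.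
- exact: cvg_powR_ratio0.
Qed.

End gamma_beta.

(** * Integrals of nonnegative functions that may be infinite *)

Section comparison.
Context d (T : measurableType d) (R : realType).
Context (mu : {measure set T -> \bar R}) (D : set T) (mD : measurable D).
Implicit Types (f g : T -> R) (a : R).

(* [fine +oo = 0], so the inequality would fail without the reverse
   comparison, which makes both integrals infinite at the same time. *)
Lemma le_Rintegral_comparable f g (C C' : R) :
  measurable_fun D f -> measurable_fun D g ->
  (forall x, D x -> 0 <= f x) -> (forall x, D x -> 0 <= g x) ->
  0 <= C -> 0 <= C' ->
  (forall x, D x -> f x <= C * g x) -> (forall x, D x -> g x <= C' * f x) ->
  \int[mu]_(x in D) f x <= C * \int[mu]_(x in D) g x.
Proof.
move=> mf mg f0 g0 C0 C'0 fg gf.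
have le_scale (u v : T -> R) (c : R) : measurable_fun D u -> measurable_fun D v ->
    (forall x, D x -> 0 <= u x) -> (forall x, D x -> 0 <= v x) -> 0 <= c ->
    (forall x, D x -> u x <= c * v x) ->
    (\int[mu]_(x in D) (u x)%:E <= c%:E * \int[mu]_(x in D) (v x)%:E)%E.
  move=> mu_ mv u0 v0 c0 uv; rewrite -ge0_integralZl//.
  - apply: ge0_le_integral => //.
    + exact/measurable_EFinP.
    + by apply/measurable_EFinP; exact: measurable_funM.
  - by apply/measurable_EFinP.
have if0 : (0 <= \int[mu]_(x in D) (f x)%:E)%E.
  by apply: integral_ge0 => x Dx; rewrite lee_fin f0.
have ig0 : (0 <= \int[mu]_(x in D) (g x)%:E)%E.
  by apply: integral_ge0 => x Dx; rewrite lee_fin g0.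
have h1 := le_scale _ _ _ mf mg f0 g0 C0 fg.
have h2 := le_scale _ _ _ mg mf g0 f0 C'0 gf.
rewrite /Rintegral.
case: (\int[mu]_(x in D) (g x)%:E)%E ig0 h1 h2 => [G||]//=; last first.
  move=> _ _; case: (\int[mu]_(x in D) (f x)%:E)%E if0 => [F||]//= _ _.
  by rewrite mulr0.
by move=> _; case: (\int[mu]_(x in D) (f x)%:E)%E if0 => [F||]//=.
Qed.

(** The sign of [f] replaces integrability: if the integral of [f] is infinite, both sides are 0, as
    [fine] sends both infinities to 0. A negative factor is reduced to a positive one by changing
    signs. *)
Lemma RintegralZl_ge0 f a : measurable_fun D f ->
  (forall x, D x -> 0 <= f x) ->
  \int[mu]_(x in D) (a * f x) = a * \int[mu]_(x in D) f x.
Proof.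
move=> mf f0; wlog a0 : a / 0 <= a.
  move=> h; have [a0|a0] := leP 0 a; first exact: h.
  have Na0 : 0 <= - a by rewrite oppr_ge0 ltW.
  have := h _ Na0; rewrite mulNr => /eqP; rewrite -eqr_oppLR => /eqP <-.
  rewrite /Rintegral -fineN -integral_ge0N; last first.
    by move=> x Dx; rewrite lee_fin mulr_ge0// f0.
  by congr fine; apply: eq_integral => x _; rewrite mulNr EFinN oppeK.
rewrite /Rintegral; under eq_integral do rewrite EFinM.
rewrite ge0_integralZl//; last exact/measurable_EFinP.
have if0 : (0 <= \int[mu]_(x in D) (f x)%:E)%E.
  by apply: integral_ge0 => x Dx; rewrite lee_fin f0.
case: (\int[mu]_(x in D) (f x)%:E)%E if0 => [F||]//= _.
move: a0; rewrite le_eqVlt => /predU1P[<-|a0]; first by rewrite mul0e mulr0.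
by rewrite gt0_muley ?lte_fin//= mulr0.
Qed.

End comparison.

(** * The Euclidean norm and points on a coordinate axis *)

Section axis.
Context {R : realType} {n : nat}.
Implicit Types (x y : 'rV[R]_n) (i : 'I_n) (e : R).

Definition axis i e : 'rV[R]_n := e *: delta_mx ord0 i.

Lemma dotp_ge0 x : 0 <= dotp x x.
Proof. by apply: sumr_ge0 => i _; exact: sqr_ge0. Qed.

Lemma enorm_ge0 x : 0 <= enorm x.
Proof. exact: sqrtr_ge0. Qed.

Lemma sqr_enorm x : enorm x ^+ 2 = dotp x x.
Proof. by rewrite sqr_sqrtr ?dotp_ge0. Qed.

Lemma dotp0l x : dotp 0 x = 0.
Proof. by rewrite /dotp big1// => i _; rewrite mxE mul0r. Qed.

Lemma enorm0 : enorm (0 : 'rV[R]_n) = 0.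
Proof. by rewrite /enorm dotp0l sqrtr0. Qed.

Lemma enormN x : enorm (- x) = enorm x.
Proof. by congr Num.sqrt; apply: eq_bigr => i _; rewrite !mxE mulrNN. Qed.

Lemma dotp_axis i e x : dotp (axis i e) x = e * x ord0 i.
Proof.
rewrite /dotp (bigD1 i)//= big1 ?addr0 => [|j ji].
  by rewrite !mxE !eqxx mulr1.
by rewrite !mxE eqxx (negbTE ji) mulr0 mul0r.
Qed.

Lemma enorm_axis i e : 0 <= e -> enorm (axis i e) = e.
Proof.
by move=> e0; rewrite /enorm dotp_axis !mxE !eqxx mulr1 -expr2 sqrtr_sqr ger0_norm.
Qed.

Lemma axis_neq0 i e : e != 0 -> axis i e != 0.
Proof.
move=> e0; apply/eqP => /matrixP /(_ ord0 i).
by rewrite !mxE !eqxx mulr1; exact/eqP.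
Qed.

Lemma normr_coord_le_enorm i x : `|x ord0 i| <= enorm x.
Proof.
rewrite -sqrtr_sqr ler_sqrt ?dotp_ge0// /dotp (bigD1 i)//= expr2 lerDl.
by apply: sumr_ge0 => j _; exact: sqr_ge0.
Qed.

Lemma sqr_enorm_axisB i e x :
  enorm (axis i e - x) ^+ 2 = e ^+ 2 - 2 * e * x ord0 i + enorm x ^+ 2.
Proof.
rewrite !sqr_enorm.
have -> : dotp (axis i e - x) (axis i e - x) =
    dotp (axis i e) (axis i e) - 2 * dotp (axis i e) x + dotp x x.
  rewrite /dotp mulr_sumr -sumrB -big_split/=; apply: eq_bigr => j _.
  by rewrite !mxE; ring.
by rewrite !dotp_axis !mxE !eqxx mulr1; ring.
Qed.

(** For a point on an axis the cross term in the squared norm is -2 e x_i, so the coordinate bound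
    |x_i| <= |x| stands in for Cauchy-Schwarz. *)
Lemma enorm_axisB_le i e x : 0 <= e -> enorm (axis i e - x) <= enorm x + e.
Proof.
move=> e0; rewrite -ler_sqr ?nnegrE ?addr_ge0 ?enorm_ge0// sqr_enorm_axisB.
have := normr_coord_le_enorm i x; rewrite ler_norml => /andP[h _].
nra.
Qed.

Lemma enorm_axisB_ge i e x : 0 <= e -> enorm x - e <= enorm (axis i e - x).
Proof.
move=> e0; have [xe|ex] := leP (enorm x) e.
  by rewrite (le_trans _ (enorm_ge0 _))// subr_le0.
rewrite -ler_sqr ?nnegrE ?enorm_ge0 ?subr_ge0 ?(ltW ex)// sqr_enorm_axisB.
have := normr_coord_le_enorm i x; rewrite ler_norml => /andP[_ h].
nra.
Qed.

End axis.

(** * The exterior integral for the pole x = 0 *)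

Section potential.
Context {R : realType} {n : nat}.
Implicit Types (s r : R) (phi : R -> R) (z : 'rV[R]_n).

Lemma measurable_enorm_rV z :
  measurable_fun [set: n.-tuple R] (fun t => enorm (z - rV_of_tuple t)).
Proof.
apply: (eq_measurable_fun (fun t => dotp (z - rV_of_tuple t) (z - rV_of_tuple t) `^ 2^-1)).
  by move=> t _; rewrite powR12_sqrt// dotp_ge0.
apply: (measurableT_comp (measurable_powR _)).
apply: measurable_sum => i; under eq_fun do rewrite -expr2 !mxE.
apply: measurable_funX; apply: measurable_funB => //.
exact: measurable_tnth.
Qed.

Lemma enorm_rV (t : n.-tuple R) : enorm (rV_of_tuple t) = enorm (0 - rV_of_tuple t).
Proof. by rewrite sub0r enormN. Qed.

(** Kept as a negation so as to coincide with the domain of integration in [green]. *)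
Definition ball_compl r : set (n.-tuple R) :=
  [set t | ~ enorm (rV_of_tuple t) < r].

Lemma ball_complP r t : ball_compl r t -> r <= enorm (rV_of_tuple t).
Proof. by move=> /negP; rewrite -leNgt. Qed.

Lemma measurable_ball_compl r : measurable (ball_compl r).
Proof.
have -> : ball_compl r =
    setT `&` (fun t => enorm (0 - rV_of_tuple t)) @^-1` `[r, +oo[.
  rewrite setTI; apply/seteqP; split => t /=; rewrite in_itv/= andbT -enorm_rV.
    exact: ball_complP.
  by move=> rt; apply/negP; rewrite -leNgt.
exact: measurable_enorm_rV.
Qed.

Lemma c_const_ge0 s : (0 < n)%N -> 0 < s -> s < 1 -> 0 <= c_const n s.
Proof.
move=> n0 s0 s1; rewrite /c_const divr_ge0 ?powR_ge0// mulr_ge0//.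
  by rewrite Gamma_ge0// divr_gt0// ltr0n.
rewrite sin_ge0_pi// mulr_ge0 ?pi_ge0 ?(ltW s0)//=.
by rewrite -[leRHS]mulr1 ler_wpM2l ?pi_ge0// ltW.
Qed.

Definition poisson0 s r (t : n.-tuple R) : R :=
  poisson_kernel s r (rV_of_tuple t) 0.

Lemma poisson0_ge0 s r t : (0 < n)%N -> 0 < s -> s < 1 -> 0 <= poisson0 s r t.
Proof.
move=> n0 s0 s1.
rewrite /poisson0 /poisson_kernel div1r; apply: mulr_ge0.
  by rewrite mulr_ge0 ?c_const_ge0 ?powR_ge0.
by rewrite invr_ge0 exprn_ge0 ?enorm_ge0.
Qed.

Lemma measurable_poisson0 s r : 0 < r ->
  measurable_fun (ball_compl r) (poisson0 s r).
Proof.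
move=> r0; pose N (t : n.-tuple R) := enorm (0 - rV_of_tuple t).
have mN : measurable_fun setT N by exact: measurable_enorm_rV.
(* Quotients are written as powers of exponent -1. The two agree for nonnegative bases, including
   base 0 on the sphere |y| = r, where both give 0. *)
apply: (eq_measurable_fun (fun t => c_const n s *
   ((r ^+ 2) * (N t ^+ 2 - r ^+ 2) `^ (-1)) `^ s * (N t ^+ n) `^ (-1))).
  move=> t; rewrite inE => /ball_complP rt.
  rewrite /poisson0 /poisson_kernel !powR_inv1 ?exprn_ge0 ?enorm_ge0//.
    by rewrite enorm0 expr0n/= subr0 div1r /N -enorm_rV.
  by rewrite /N -enorm_rV subr_ge0 ler_sqr// nnegrE ?enorm_ge0 ?ltW.
apply: measurable_funTS; apply: measurable_funM.
  apply: measurable_funM => //.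
  apply: (measurableT_comp (measurable_powR _)).
  apply: measurable_funM => //.
  apply: (measurableT_comp (measurable_powR _)).
  by apply: measurable_funB => //; exact: measurable_funX.
by apply: (measurableT_comp (measurable_powR _)); exact: measurable_funX.
Qed.

(** The profile [phi] is the radial fundamental solution without its constant: a power for n <> 2s,
    the logarithm for n = 2s. *)
Definition potential phi s r z : R :=
  \int[lebesgue_tuple R n]_(t in ball_compl r)
    (phi (enorm (z - rV_of_tuple t)) * poisson0 s r t).

Lemma measurable_potential_integrand phi s r z :
  measurable_fun setT phi -> 0 < r ->
  measurable_fun (ball_compl r)
    (fun t => phi (enorm (z - rV_of_tuple t)) * poisson0 s r t).
Proof.
move=> mphi r0; apply: measurable_funM; last exact: measurable_poisson0.
apply: measurable_funTS; apply: measurableT_comp => //.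
exact: measurable_enorm_rV.
Qed.

Lemma le_potential phi s r z z' (C C' : R) : (0 < n)%N -> 0 < s -> s < 1 ->
  0 < r -> measurable_fun setT phi -> 0 <= C -> 0 <= C' ->
  (forall y, r <= enorm y ->
    [/\ 0 <= phi (enorm (z - y)), 0 <= phi (enorm (z' - y)),
        phi (enorm (z - y)) <= C * phi (enorm (z' - y)) &
        phi (enorm (z' - y)) <= C' * phi (enorm (z - y))]) ->
  potential phi s r z <= C * potential phi s r z'.
Proof.
move=> n0 s0 s1 r0 mphi C0 C'0 h.
apply: (@le_Rintegral_comparable _ _ _ _ _ _ _ _ C C') => //.
- exact: measurable_ball_compl.
- exact: measurable_potential_integrand.
- exact: measurable_potential_integrand.
- by move=> t /ball_complP /h[a _ _ _]; rewrite mulr_ge0 ?poisson0_ge0.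
- by move=> t /ball_complP /h[_ a _ _]; rewrite mulr_ge0 ?poisson0_ge0.
- by move=> t /ball_complP /h[_ _ a _]; rewrite mulrA ler_wpM2r ?poisson0_ge0.
- by move=> t /ball_complP /h[_ _ _ a]; rewrite mulrA ler_wpM2r ?poisson0_ge0.
Qed.

Lemma potential_ge0 phi s r z : (0 < n)%N -> 0 < s -> s < 1 ->
  (forall y, r <= enorm y -> 0 <= phi (enorm (z - y))) ->
  0 <= potential phi s r z.
Proof.
move=> n0 s0 s1 h; apply: Rintegral_ge0 => t /ball_complP /h a.
by rewrite mulr_ge0 ?poisson0_ge0.
Qed.

End potential.

(** * The Green identity between the origin and a point of an axis *)

Section origin.
Context {R : realType} {n : nat}.
Implicit Types (s r e kappa : R) (i : 'I_n).

(** The constant [a_const] is negative for n < 2s and the exterior integral is not known to be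
    finite; [RintegralZl_ge0] takes the constant out all the same. *)
Lemma green_axis_noncritical s r i e : (0 < n)%N -> 0 < s -> s < 1 ->
  n%:R != 2 * s -> 0 < r -> 0 <= e ->
  green s r 0 (axis i e) =
  a_const n s * (e `^ (2 * s - n%:R) -
    potential (@powR R ^~ (2 * s - n%:R)) s r (axis i e)).
Proof.
move=> n0 s0 s1 ns r0 e0.
rewrite /green /fundamental_solution (negbTE ns) sub0r enormN enorm_axis//.
rewrite addrC (addrC (- n%:R)) mulrBr addrC; congr (_ - _).
rewrite -RintegralZl_ge0.
- by apply: eq_Rintegral => t _; rewrite mulrA.
- exact: measurable_ball_compl.
- by apply: (@measurable_potential_integrand _ _ (@powR R ^~ _)) => //.
- by move=> t _; rewrite mulr_ge0 ?powR_ge0 ?poisson0_ge0.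
Qed.

(** The identity in the unit ball with x = 0 and |z| = e, where r_0 becomes (1 - e^2) / e^2. *)
Lemma green_constant_noncritical s kappa i e :
  0 < s -> s < 1 -> n%:R != 2 * s -> is_green_constant n s kappa ->
  0 < e -> e < 1 ->
  a_const n s * (e `^ (2 * s - n%:R) -
    potential (@powR R ^~ (2 * s - n%:R)) s 1 (axis i e)) =
  kappa * e `^ (2 * s - n%:R) *
    incomplete_beta s (n%:R / 2) ((1 - e ^+ 2) / e ^+ 2).
Proof.
move=> s0 s1 ns gk e0 e1; have n0 : (0 < n)%N by case: n i {ns gk} => [[]|].
rewrite -green_axis_noncritical ?(ltW e0)// (gk 1)//.
- rewrite (negbTE ns) subr0 enorm_axis ?(ltW e0)//; congr (_ * _).
  rewrite /r0 enorm0 sub0r enormN enorm_axis ?(ltW e0)//.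
  by rewrite expr1n expr0n/= subr0 !mul1r.
- by rewrite enorm0.
- by rewrite enorm_axis ?ltW.
- by rewrite eq_sym axis_neq0// gt_eqF.
Qed.

(** Outside the unit ball e <= e |x|, which turns the triangle inequalities into multiplicative
    bounds that are compatible with powers. *)
Lemma enorm_ratio_axis i e (x : 'rV[R]_n) : 0 <= e -> 1 <= enorm x ->
  (1 - e) * enorm x <= enorm (axis i e - x) <= (1 + e) * enorm x.
Proof.
move=> e0 x1; rewrite mulrBl mulrDl mul1r; apply/andP; split.
  by apply: le_trans (enorm_axisB_ge i x e0); rewrite lerB// ler_peMr.
by apply: (le_trans (enorm_axisB_le i x e0)); rewrite lerD// ler_peMr.
Qed.

(** Radius 4 is chosen so that |z - y| >= 3 on the exterior when e <= 1; the logarithm is then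
    nonnegative there and the comparison lemmas apply. *)
Lemma green_constant_critical s kappa i e :
  0 < s -> s < 1 -> n%:R == 2 * s -> is_green_constant n s kappa ->
  0 < e -> e <= 1 ->
  - pi^-1 * ln e + pi^-1 * potential (@ln R) s 4 (axis i e) =
  kappa * (ln ((4 ^+ 2 + Num.sqrt (4 ^+ 2 * (4 ^+ 2 - e ^+ 2))) / 4) - ln e).
Proof.
move=> s0 s1 ns gk e0 e1; have n0 : (0 < n)%N by case: n i {ns gk} => [[]|].
have e4 : e < 4 by lra.
have /gk : (0 : R) < 4 by [].
move=> /(_ 0 (axis i e)); rewrite enorm0 enorm_axis ?(ltW e0)//.
have z0 : 0 != axis i e by rewrite eq_sym axis_neq0// gt_eqF.
move=> /(_ (ltr0Sn _ 3) e4 z0); rewrite ns dotp0l subr0 expr0n/= !subr0 enorm_axis ?(ltW e0)//.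
rewrite invfM mulrA [ln (_ * e^-1)]ln_div ?posrE// => <-.
rewrite /green /fundamental_solution ns sub0r enormN enorm_axis ?(ltW e0)//.
rewrite /a_const ns; congr (_ + _).
rewrite -[LHS]opprK -mulNr; congr (- _).
rewrite -RintegralZl_ge0.
- by apply: eq_Rintegral => t _; rewrite mulrA.
- exact: measurable_ball_compl.
- by apply: (@measurable_potential_integrand _ _ (@ln R)) => //.
- move=> t /ball_complP t4; rewrite mulr_ge0 ?poisson0_ge0// ln_ge0//.
  by have := enorm_axisB_ge i (rV_of_tuple t) (ltW e0); lra.
Qed.

End origin.

(** * The sequence of test radii and its powers *)

Section limits.
Context {R : realType}.
Implicit Types (p q e u v c : R).

(** Chosen so that e^2 = 1 / (k + 1), which makes the upper limit (1 - e^2) / e^2 of the Green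
    formula exactly the integer k. *)
Definition radius (k : nat) : R := k.+1%:R `^ (- 2^-1).

Lemma radius_gt0 k : 0 < radius k. Proof. by rewrite powR_gt0. Qed.

Lemma powR_radius k p : radius k `^ p = k.+1%:R `^ (- (p / 2)).
Proof. by rewrite -powRrM; congr powR; field. Qed.

Lemma sqr_radius k : radius k ^+ 2 = k.+1%:R^-1.
Proof.
rewrite -powR_mulrn ?(ltW (radius_gt0 k))// powR_radius divff ?pnatr_eq0//.
by rewrite powR_inv1.
Qed.

Lemma radius_ratio k : (1 - radius k ^+ 2) / radius k ^+ 2 = k%:R.
Proof.
rewrite sqr_radius invrK mulrBl mul1r mulVf ?pnatr_eq0//.
by rewrite -natr1 addrK.
Qed.

Lemma radius_le_half k : (3 <= k)%N -> radius k <= 2^-1.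
Proof.
move=> k3; rewrite -ler_sqr ?nnegrE ?(ltW (radius_gt0 k))// sqr_radius.
rewrite exprVn lef_pV2 ?posrE ?exprn_gt0// -natrX ler_nat.
exact: leq_ltn_trans k3 _.
Qed.

Lemma cvg_powRN_succn p : 0 < p -> k.+1%:R `^ (- p) @[k --> \oo] --> (0 : R).
Proof.
move=> p0; rewrite (cvg_shiftS (fun k : nat => (k%:R : R) `^ (- p))).
apply: (@cvg_comp _ _ _ (fun k : nat => k%:R) (@powR R ^~ (- p))).
  exact: cvgr_idn.
exact: powRN_cvgy.
Qed.

Lemma le0_powR_scale p c u v : p <= 0 -> 0 < c -> 0 < u -> c * u <= v ->
  v `^ p <= c `^ p * u `^ p.
Proof.
move=> p0 c0 u0 cuv; have cu0 : 0 < c * u by rewrite mulr_gt0.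
have v0 : 0 < v by exact: lt_le_trans cuv.
rewrite -powRM ?(ltW c0) ?(ltW u0)// -[p]opprK -(@powRV _ (- p) _ v0) -(@powRV _ (- p) _ cu0).
by rewrite ge0_ler_powR ?nnegrE ?oppr_ge0 ?invr_ge0 ?(ltW cu0) ?(ltW v0)// lef_pV2.
Qed.

End limits.

(** * The case n > 2s *)

Section subcritical.
Context {R : realType} {n : nat}.
Implicit Types (s kappa e : R) (i : 'I_n).

(** For e <= 1/2 each of |z - y| and |y| is at least half the other; the negative exponent turns
    this into the factor (1/2)^(2s-n) in both directions. *)
Lemma potential_le_subcritical s i e : 0 < s -> s < 1 -> 2 * s < n%:R ->
  0 < e -> e <= 2^-1 ->
  potential (@powR R ^~ (2 * s - n%:R)) s 1 (axis i e) <=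
  2^-1 `^ (2 * s - n%:R) * potential (@powR R ^~ (2 * s - n%:R)) s 1 (0 : 'rV_n).
Proof.
move=> s0 s1 ns e0 e2; have n0 : (0 < n)%N by case: n i {ns} => [[]|].
have p0 : 2 * s - n%:R <= 0 by rewrite subr_le0 ltW.
apply: (@le_potential _ _ _ _ _ _ _ _ (2^-1 `^ (2 * s - n%:R))) => //.
move=> y y1; have /andP[h1 h2] := enorm_ratio_axis i (ltW e0) y1.
have y0 : 0 < enorm y by exact: lt_le_trans y1.
have zy0 : 0 < enorm (axis i e - y) by apply: lt_le_trans h1; rewrite mulr_gt0//; lra.
rewrite sub0r enormN; split; rewrite ?powR_ge0//; apply: le0_powR_scale => //.
- by apply: le_trans h1; rewrite ler_wpM2r ?(ltW y0)//; lra.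
- have : e * enorm y <= 2^-1 * enorm y by rewrite ler_wpM2r ?(ltW y0).
  by move: h2; rewrite mulrDl mul1r; lra.
Qed.

(** Divide the identity by e^(2s-n) and let e tend to 0: the bounded potential is multiplied by
    e^(n-2s) and disappears, while the incomplete Beta integral becomes B(s, n/2 - s). *)
Lemma green_constant_subcritical s kappa : (0 < n)%N -> 0 < s -> s < 1 ->
  2 * s < n%:R -> is_green_constant n s kappa ->
  a_const n s = kappa * (Gamma s * Gamma (n%:R / 2 - s) / Gamma (n%:R / 2)).
Proof.
move=> n0 s0 s1 ns gk; pose i : 'I_n := Ordinal n0.
set p := 2 * s - n%:R; have p0 : p < 0 by rewrite subr_lt0.
pose K k := potential (@powR R ^~ p) s 1 (axis i (radius k)).
pose K0 := potential (@powR R ^~ p) s 1 (0 : 'rV[R]_n).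
have sn : s < n%:R / 2 by rewrite ltr_pdivlMr// mulrC.
have h1 := @cvg_incomplete_beta R s (n%:R / 2) s0 sn.
have h2 : radius k `^ (- p) * K k @[k --> \oo] --> (0 : R).
  apply: (@squeeze_cvgr _ _ _ _ (cst 0) (fun k => radius k `^ (- p) * (2^-1 `^ p * K0))).
  - near=> k; have k3 : (3 <= k)%N by near: k; exact: nbhs_infty_ge.
    rewrite mulr_ge0 ?powR_ge0 ?potential_ge0//=; last by move=> y _; rewrite powR_ge0.
    rewrite ler_wpM2l ?powR_ge0// potential_le_subcritical ?radius_gt0//.
    exact: radius_le_half.
  - exact: cvg_cst.
  - rewrite -(mul0r (2^-1 `^ p * K0)); apply: cvgM; last exact: cvg_cst.
    under eq_fun do rewrite powR_radius.
    by apply: cvg_powRN_succn; rewrite divr_gt0// oppr_gt0.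
have h3 : a_const n s * (1 - radius k `^ (- p) * K k) @[k --> \oo] -->
    a_const n s * (1 - 0).
  apply: cvgM; first exact: cvg_cst.
  by apply: cvgB => //; exact: cvg_cst.
rewrite subr0 mulr1 in h3.
apply: (cvg_unique _ h3) => //=.
apply: cvg_trans (cvgM (cvg_cst kappa) h1).
apply: near_eq_cvg; near=> k.
have k3 : (3 <= k)%N by near: k; exact: nbhs_infty_ge.
have r1 : radius k < 1 :> R by apply: le_lt_trans (radius_le_half k3) _; lra.
have n2s : n%:R != 2 * s by rewrite gt_eqF.
have := green_constant_noncritical i s0 s1 n2s gk (radius_gt0 k) r1.
rewrite radius_ratio -/p -/(K k) => E.
(* Multiplying back by e^(2s-n) reduces the claim to the Green identity [E]. *)
apply: (@mulIf _ (radius k `^ p)); first by rewrite gt_eqF// powR_gt0 ?radius_gt0.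
rewrite /= mulrAC -E -mulrA mulrBl mul1r; congr (_ * (_ - _)).
rewrite mulrAC -powRD; last by rewrite (gt_eqF (radius_gt0 k)) implybT.
by rewrite addNr powRr0 mul1r.
Unshelve. all: by end_near. Qed.

End subcritical.

(** * The case n = 2s *)

Section critical.
Context {R : realType} {n : nat}.
Implicit Types (s kappa e : R) (i : 'I_n).

(** The factor 2 comes from squaring: with |y| >= 4 and |z - y| >= 3, each of the two norms is at
    most the other plus 1, hence at most the square of the other. *)
Lemma potential_le_critical s i e : 0 < s -> s < 1 -> 0 < e -> e <= 1 ->
  potential (@ln R) s 4 (axis i e) <= 2 * potential (@ln R) s 4 (0 : 'rV_n).
Proof.
move=> s0 s1 e0 e1; have n0 : (0 < n)%N by case: n i => [[]|].
apply: (@le_potential _ _ _ _ _ _ _ _ 2) => // y y4.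
have h1 := enorm_axisB_ge i y (ltW e0).
have h2 := enorm_axisB_le i y (ltW e0).
have lnX2 (u : R) : 0 < u -> 2 * ln u = ln (u ^+ 2).
  by move=> u0; rewrite lnXn// mulr_natl.
have y0 : 0 < enorm y by lra.
have z0 : 0 < enorm (axis i e - y) by lra.
rewrite sub0r enormN; split; rewrite ?ln_ge0//; try lra.
- by rewrite lnX2// ler_ln ?posrE ?exprn_gt0//; nra.
- by rewrite lnX2// ler_ln ?posrE ?exprn_gt0//; nra.
Qed.

(* Both sides are [kappa] resp. [1 / pi] times [- ln e], up to terms that stay
   bounded as [e] tends to [0]. *)
Lemma green_constant_critical_eq s kappa : (0 < n)%N -> 0 < s -> s < 1 ->
  n%:R == 2 * s -> is_green_constant n s kappa -> kappa = pi^-1.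
Proof.
move=> n0 s0 s1 ns gk; pose i : 'I_n := Ordinal n0.
pose K0 := potential (@ln R) s 4 (0 : 'rV[R]_n).
pose M := pi^-1 * (2 * K0) + `|kappa| * ln 8.
(* Here t = - ln e. The remaining logarithm has its argument in [1, 8] and the potential lies in
   [0, 2 K0], whence the value of [M]. *)
have bound t : 0 <= t -> `|kappa - pi^-1| * t <= M.
  move=> t0; pose e := expR (- t).
  have e0 : 0 < e by exact: expR_gt0.
  have e1 : e <= 1 by rewrite -expR0 ler_expR oppr_le0.
  have := green_constant_critical i s0 s1 ns gk e0 e1.
  rewrite /e expRK -/e mulrNN.
  set A := (X in ln X) => E.
  have A1 : 1 <= A.
    rewrite ler_pdivlMr// mul1r (@le_trans _ _ (4 ^+ 2))//; first by lra.
    by rewrite lerDl sqrtr_ge0.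
  have A8 : A <= 8.
    rewrite ler_pdivrMr// (_ : 8 * 4 = 4 ^+ 2 + 4 ^+ 2); last by lra.
    rewrite lerD2l -[leRHS]ger0_norm ?exprn_ge0// -sqrtr_sqr ler_sqrt ?sqr_ge0//.
    rewrite -[leRHS]/(4 ^+ 2 * 4 ^+ 2) ler_wpM2l ?exprn_ge0//.
    by rewrite gerBl sqr_ge0.
  have lA0 : 0 <= ln A by rewrite ln_ge0.
  have lA8 : ln A <= ln 8 by rewrite ler_ln ?posrE//; lra.
  set K := potential _ _ _ _ in E.
  have K2 : K <= 2 * K0 by exact: potential_le_critical.
  have Kge0 : 0 <= K.
    apply: potential_ge0 => // y y4; rewrite ln_ge0//.
    by have := enorm_axisB_ge i y (ltW e0); lra.
  have -> : `|kappa - pi^-1| * t = `|pi^-1 * K - kappa * ln A|.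
    rewrite -[in LHS](ger0_norm t0) -normrM; congr `|_|.
    by move: E; rewrite mulrBr mulrN opprK mulrBl; lra.
  rewrite (le_trans (ler_normB _ _))// lerD//.
    by rewrite ger0_norm ?mulr_ge0 ?invr_ge0 ?pi_ge0// ler_wpM2l ?invr_ge0 ?pi_ge0.
  by rewrite normrM (ger0_norm lA0) ler_wpM2l.
(* A linear function bounded on the half-line has slope 0: otherwise t = (M + 1) / |kappa - 1/pi|
   would give M + 1 <= M. *)
apply/eqP; rewrite -subr_eq0 -normr_eq0; apply/negPn/negP => d0.
have d0' : 0 < `|kappa - pi^-1| by rewrite lt_neqAle eq_sym d0 normr_ge0.
have M0 : 0 <= M by have := bound 0 (lexx _); rewrite mulr0.
have M10 : 0 <= M + 1 by exact: addr_ge0.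
have := bound _ (divr_ge0 M10 (ltW d0')).
by rewrite mulrC divfK// leNgt ltrDl ltr01.
Qed.

End critical.

(** * The case n < 2s *)

Section supercritical.
Context {R : realType} {n : nat}.
Implicit Types (s kappa e : R) (i : 'I_n).

(** The exponent p = 2s - n lies in [0, 1], so (1 + e)^p <= 1 + e and (1 - e)^p >= 1 - e. Hence |z -
    y|^p lies between (1 - e)|y|^p and (1 + e)|y|^p. *)
Lemma potential_supercritical s i e : 0 < s -> s < 1 -> n%:R < 2 * s ->
  0 < e -> e <= 2^-1 ->
  `|potential (@powR R ^~ (2 * s - n%:R)) s 1 (axis i e) -
    potential (@powR R ^~ (2 * s - n%:R)) s 1 (0 : 'rV_n)| <=
  e * potential (@powR R ^~ (2 * s - n%:R)) s 1 (0 : 'rV_n).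
Proof.
move=> s0 s1 ns e0 e2; have n0 : (0 < n)%N by case: n i {ns} => [[]|].
set p := 2 * s - n%:R; have p0 : 0 <= p by rewrite subr_ge0 ltW.
have p1 : p <= 1.
  have : 1 <= n%:R :> R by rewrite ler1n.
  by rewrite /p; lra.
have e1 : 0 < 1 - e by lra.
have cmp (y : 'rV[R]_n) : 1 <= enorm y ->
    enorm (axis i e - y) `^ p <= (1 + e) * enorm y `^ p /\
    enorm y `^ p <= (1 - e)^-1 * enorm (axis i e - y) `^ p.
  move=> y1; have /andP[h1 h2] := enorm_ratio_axis i (ltW e0) y1.
  have y0 : 0 <= enorm y by exact: enorm_ge0.
  have z0 := enorm_ge0 (axis i e - y).
  split.
    apply: (@le_trans _ _ (((1 + e) * enorm y) `^ p)).
      by rewrite ge0_ler_powR ?nnegrE// mulr_ge0//; lra.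
    rewrite powRM//; last by lra.
    by rewrite ler_wpM2r ?powR_ge0// ler1_powR//; lra.
  rewrite mulrC ler_pdivlMr// mulrC.
  apply: (@le_trans _ _ (((1 - e) * enorm y) `^ p)).
    rewrite powRM//; last by lra.
    by rewrite ler_wpM2r ?powR_ge0// ger1_powR//; lra.
  by rewrite ge0_ler_powR ?nnegrE// mulr_ge0//; lra.
set K := potential _ _ _ (axis i e); set K0 := potential _ _ _ 0.
have KK0 : K <= (1 + e) * K0.
  apply: (@le_potential _ _ _ _ _ _ _ _ (1 - e)^-1) => //.
  - by lra.
  - by rewrite invr_ge0; lra.
  by move=> y /cmp[]; rewrite sub0r enormN; split; rewrite ?powR_ge0.
have K0K : K0 <= (1 - e)^-1 * K.
  apply: (@le_potential _ _ _ _ _ _ _ _ (1 + e)) => //.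
  - by rewrite invr_ge0; lra.
  - by lra.
  by move=> y /cmp[]; rewrite sub0r enormN; split; rewrite ?powR_ge0.
rewrite mulrC ler_pdivlMr// in K0K.
by rewrite ler_norml; lra.
Qed.

(* The leading terms of the identity as [e] tends to [0] give
   [kappa = (1/2 - s) a K0]; the wanted relation is that of the next order,
   [e `^ (2 s - 1)], where the unknown [K0] has disappeared. *)
Lemma green_constant_supercritical s kappa : n = 1%N -> 0 < s -> s < 1 ->
  1 < 2 * s -> is_green_constant n s kappa ->
  (s - 2^-1) * a_const n s =
  - (kappa * (Gamma s * Gamma (3 / 2 - s) / Gamma (1 / 2))).
Proof.
move=> n1 s0 s1 ns gk; rewrite div1r; have n0 : (0 < n)%N by rewrite n1.
pose i : 'I_n := Ordinal n0.
set p := 2 * s - n%:R; set sg := s - 2^-1; set a := a_const n s.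
have sg0 : 0 < sg by rewrite /sg; lra.
have sg1 : sg < 2^-1 by rewrite /sg; lra.
have psg : p / 2 = sg by rewrite /p n1 /sg; field.
pose N k : R := k.+1%:R.
have N0 k : 0 < N k by rewrite ltr0n.
pose K k := potential (@powR R ^~ p) s 1 (axis i (radius k)).
pose K0 := potential (@powR R ^~ p) s 1 (0 : 'rV[R]_n).
pose I k := incomplete_beta s (2^-1 + 1) k%:R.
pose B : R := Gamma s * Gamma (3 / 2 - s) / Gamma 2^-1.
have G3 : Gamma (2^-1 + 1) = 2^-1 * Gamma 2^-1 :> R by rewrite GammaD1.
have Gh : 0 < Gamma 2^-1 :> R by exact: Gamma_gt0.
(* The raised exponent 3/2 exceeds s, so the Beta limit exists; the factor 1/2 cancels in Gamma(3/2)
   = Gamma(1/2) / 2. *)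
have cI : 2^-1 * I k @[k --> \oo] --> B.
  have -> : B = 2^-1 * (Gamma s * Gamma (2^-1 + 1 - s) / Gamma (2^-1 + 1)).
    rewrite G3 (_ : 2^-1 + 1 = 3 / 2 :> R); last by field.
    by rewrite /B; field; rewrite gt_eqF.
  apply: cvgM; first exact: cvg_cst.
  by apply: cvg_incomplete_beta => //; lra.
have cN q : 0 < q -> N k `^ (- q) @[k --> \oo] --> 0 by exact: cvg_powRN_succn.
have cN1 : N k `^ (sg - 2^-1) * K0 @[k --> \oo] --> 0.
  rewrite -(mul0r K0); apply: cvgM; last exact: cvg_cst.
  by rewrite (_ : sg - 2^-1 = - (2^-1 - sg)); [apply: cN; lra|ring].
have cN2 : N k `^ (sg - 1) @[k --> \oo] --> 0.
  by rewrite (_ : sg - 1 = - (1 - sg)); [apply: cN; lra|ring].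
have K0ge0 : 0 <= K0 by apply: potential_ge0 => // y _; rewrite powR_ge0.
(* The variation of the potential is at most e K0 with e = N^(-1/2); it stays negligible after
   multiplication by N^sg because sg < 1/2. *)
have dK k : (3 <= k)%N -> `|N k `^ sg * (K k - K0)| <= N k `^ (sg - 2^-1) * K0.
  move=> k3; rewrite normrM ger0_norm ?powR_ge0//.
  rewrite powRD; last by rewrite (gt_eqF (N0 k)) implybT.
  rewrite -mulrA ler_wpM2l ?powR_ge0//.
  apply: potential_supercritical; rewrite ?radius_gt0//; first by rewrite n1.
  exact: radius_le_half.
(* On [0, 1] one has u <= u^s <= 1; at u = k/N = 1 - 1/N this puts u^s within 1/N of 1. *)
have dN k : `|N k `^ sg * ((k%:R / N k) `^ s - 1)| <= N k `^ (sg - 1).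
  rewrite normrM ger0_norm ?powR_ge0//.
  rewrite powRD; last by rewrite (gt_eqF (N0 k)) implybT.
  rewrite ler_wpM2l ?powR_ge0// powR_inv1 ?(ltW (N0 k))//.
  have kN : k%:R / N k = 1 - (N k)^-1.
    by rewrite /N -natr1; field; rewrite natr1 pnatr_eq0.
  have kN0 : 0 <= k%:R / N k by rewrite divr_ge0// ltW.
  have kN1 : k%:R / N k <= 1 by rewrite kN gerBl invr_ge0 ltW.
  have hi : (k%:R / N k) `^ s <= 1.
    suff : (k%:R / N k) `^ s <= 1 `^ s by rewrite powR1.
    by rewrite ge0_ler_powR ?nnegrE// ltW.
  have lo : k%:R / N k <= (k%:R / N k) `^ s.
    move: kN0; rewrite le_eqVlt => /predU1P[<-|kN0]; first by rewrite powR_ge0.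
    by rewrite ger1_powR ?kN0// ltW.
  rewrite distrC ger0_norm ?subr_ge0//.
  by rewrite lerBlDr -lerBlDl -kN.
(* The Green identity multiplied by sg N^sg, with [incomplete_beta_rec] at m = 1/2 replacing the
   divergent integral by the convergent [I k] and a boundary term. *)
have id k : (3 <= k)%N ->
    sg * a - sg * a * (N k `^ sg * (K k)) =
    kappa * (N k `^ sg * (k%:R / N k) `^ s) - kappa * (2^-1 * I k).
  move=> k3; have k0 : 0 < k%:R :> R by rewrite ltr0n (leq_trans _ k3).
  have r1 : radius k < 1 :> R by apply: le_lt_trans (radius_le_half k3) _; lra.
  have n2s : n%:R != 2 * s by rewrite n1 lt_eqF.
  have := green_constant_noncritical i s0 s1 n2s gk (radius_gt0 k) r1.
  rewrite radius_ratio -/p -/(K k) powR_radius psg -/(N k) n1 div1r => E.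
  have := @incomplete_beta_rec R s 2^-1 k%:R.
  rewrite invr_gt0 ltr0n => /(_ isT); rewrite -/sg -/(I k) => /(_ _ k0).
  have -> : 2^-1 <= s by lra.
  move=> /(_ isT) J.
  have NN : N k `^ sg * N k `^ (- sg) = 1.
    by rewrite powRN divff// gt_eqF// powR_gt0.
  have Ns : k%:R `^ s * (k%:R + 1) `^ (- 2^-1) = N k `^ sg * (k%:R / N k) `^ s.
    rewrite powRM ?invr_ge0 ?(ltW (N0 k)) ?(ltW k0)// powRV//.
    rewrite mulrCA -powRD; last by rewrite (gt_eqF (N0 k)) implybT.
    by rewrite natr1; congr (_ * _ `^ _); rewrite /sg; ring.
  rewrite -Ns -mulrBr -J.
  transitivity (N k `^ sg * (sg * (a * (N k `^ (- sg) - K k)))).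
    rewrite -[in LHS](mulr1 (sg * a)) -[in X in X - _]NN; ring.
  rewrite /a n1 E.
  transitivity (N k `^ sg * N k `^ (- sg) * (kappa * (sg * incomplete_beta s 2^-1 k%:R))).
    ring.
  by rewrite NN; ring.
(* All terms growing like N^sg are collected in [c]; [X k] gathers the rest, and converges to sg a +
   kappa B. *)
pose c := sg * a * K0 + kappa.
pose X k := sg * a - sg * a * (N k `^ sg * (K k - K0)) -
  kappa * (N k `^ sg * ((k%:R / N k) `^ s - 1)) + kappa * (2^-1 * I k).
have Xc k : (3 <= k)%N -> X k = N k `^ sg * c.
  by move=> /id h; rewrite /X /c; move: h; rewrite !mulrBr; lra.
have squeeze0 (u v : nat -> R) : (forall k, (3 <= k)%N -> `|u k| <= v k) ->
    v k @[k --> \oo] --> 0 -> u k @[k --> \oo] --> 0.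
  move=> uv v0; apply/norm_cvg0P.
  apply: (@squeeze_cvgr _ _ _ _ (cst 0) v) => //; last exact: cvg_cst.
  near=> k; rewrite normr_ge0 uv//.
  by near: k; exact: nbhs_infty_ge.
have cX : X k @[k --> \oo] --> sg * a - sg * a * 0 - kappa * 0 + kappa * B.
  apply: cvgD; last by apply: cvgM => //; exact: cvg_cst.
  apply: cvgB; last first.
    apply: cvgM; first exact: cvg_cst.
    by apply: squeeze0 cN2 => k _; exact: dN.
  apply: cvgB; first exact: cvg_cst.
  apply: cvgM; first exact: cvg_cst.
  exact: squeeze0 cN1.
rewrite !mulr0 !subr0 in cX.
(* A convergent [X k] equal to N^sg c, with N^sg unbounded, forces c = 0. Then [X k] vanishes from k
   = 3 on, and so does its limit, which is the wanted relation. *)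
have c0 : c = 0.
  have : N k `^ (- sg) * X k @[k --> \oo] --> 0 * (sg * a + kappa * B).
    by apply: cvgM => //; exact: cN.
  rewrite mul0r => h; apply: (@cvg_unique _ _ (N k `^ (- sg) * X k @[k --> \oo])) => //.
  apply: cvg_near_cst; near=> k.
  rewrite Xc; last by near: k; exact: nbhs_infty_ge.
  by rewrite powRN mulKf// gt_eqF// powR_gt0.
have : sg * a + kappa * B = 0.
  apply: (@cvg_unique _ _ (X k @[k --> \oo])) => //.
  apply: cvg_near_cst; near=> k.
  by rewrite Xc ?c0 ?mulr0//; near: k; exact: nbhs_infty_ge.
by move=> /eqP; rewrite addr_eq0 => /eqP.
Unshelve. all: by end_near. Qed.

End supercritical.

(** * Solving the three relations for kappa *)

Theorem theorem3p3 (R : realType) (n : nat) (s : R) (kappa : R) :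
  (1 <= n)%N -> 0 < s -> s < 1 ->
  is_green_constant n s kappa ->
  (n%:R <> 2 * s ->
     kappa = Gamma (n%:R / 2) / (2 `^ (2 * s) * pi `^ (n%:R / 2) * Gamma s ^+ 2))
  /\ (n%:R = 2 * s -> kappa = 1 / pi).
Proof.
move=> n0 s0 s1 gk; split=> [/eqP ns|/eqP ns]; last first.
  by rewrite div1r; exact: (green_constant_critical_eq n0 s0 s1 ns gk).
have Gs : Gamma s != 0 by rewrite gt_eqF// Gamma_gt0.
have Gn : Gamma (n%:R / 2) != 0 :> R.
  by rewrite gt_eqF// Gamma_gt0// divr_gt0// ltr0n.
have p2 : 2 `^ (2 * s) != 0 by rewrite gt_eqF// powR_gt0.
have ppi : pi `^ (n%:R / 2) != 0 :> R by rewrite gt_eqF// powR_gt0// pi_gt0.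
have [sn|ns'] := ltP (2 * s) n%:R.
  have Gns : Gamma (n%:R / 2 - s) != 0.
    by rewrite gt_eqF// Gamma_gt0// subr_gt0 ltr_pdivlMr// mulrC.
  have := green_constant_subcritical n0 s0 s1 sn gk.
  rewrite /a_const (negbTE ns) => E.
  have -> : kappa = kappa * (Gamma s * Gamma (n%:R / 2 - s) / Gamma (n%:R / 2)) *
      Gamma (n%:R / 2) / (Gamma s * Gamma (n%:R / 2 - s)).
    by field; rewrite Gs Gn Gns.
  by rewrite -E; field; rewrite Gs Gns p2 ppi.
have {ns'}ns' : n%:R < 2 * s by rewrite lt_neqAle ns.
(* Here n < 2s < 2. *)
have n1 : n = 1%N.
  apply/eqP; rewrite eqn_leq n0 andbT -ltnS -(ltr_nat R).
  by apply: (lt_trans ns'); lra.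
subst n.
have s12 : 1 < 2 * s by [].
have G3 : Gamma (3 / 2 - s) != 0 by rewrite gt_eqF// Gamma_gt0//; lra.
(* Since s - 1/2 lies in (0, 1), its truncation is 0, and the continuation in [Gamma] takes exactly
   one step. *)
have Ga : Gamma (1 / 2 - s) = Gamma (3 / 2 - s) / (1 / 2 - s).
  have h1 : (0 < 1 / 2 - s) = false by apply/negbTE; rewrite -leNgt; lra.
  rewrite {1}/Gamma h1 (_ : Num.truncn (- (1 / 2 - s)) = 0%N); last first.
    by apply/truncn0Pn; rewrite -ltNge; lra.
  rewrite big_ord1 addr0 /Gamma (_ : 0 < 3 / 2 - s); last by lra.
  by rewrite (_ : 1 / 2 - s + 1%:R = 3 / 2 - s)//; field.
(* The factor s - 1/2 of this relation cancels the denominator 1/2 - s of [Ga] up to sign, and the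
   sign is the one on the right-hand side. *)
have := green_constant_supercritical erefl s0 s1 s12 gk.
rewrite /a_const (negbTE ns) Ga => E.
have -> : kappa = - (- (kappa * (Gamma s * Gamma (3 / 2 - s) / Gamma (1 / 2)))) *
    Gamma (1 / 2) / (Gamma s * Gamma (3 / 2 - s)).
  by field; rewrite Gs Gn G3.
rewrite -E; field.
by rewrite Gs G3 p2 ppi /= lt_eqF//; lra.
Qed.
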